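(* Unweighted Robust Stable Set is solvable in polynomial time on bipartite graphs.
   Context: Unweighted Robust Stable Set: given a graph $G=(V,E)$, with $\mathcal{F}$ the family of stable sets of $G$, solve $$\max_{S\in\mathcal{F}}\ \min_{f\in V\cup\{\emptyset\}}\ \max_{\substack{e\in (V\setminus(S\cup\{f\}))\cup\{\emptyset\}\\ (S\setminus\{f\})\cup\{e\}\in\mathcal{F}}} |(S\setminus\{f\})\cup\{e\}|,$$ where $f=\emptyset$ means no vertex is deleted and $e=\emptyset$ means no vertex is added. *)

(* Defs.v *)
From mathcomp Require Import all_boot.
Set Implicit Arguments. Unset Strict Implicit. Unset Printing Implicit Defensive.

Definition simple_graph n (e : rel 'I_n) : Prop := symmetric e /\ irreflexive e.

Definition bipartite n (e : rel 'I_n) : Prop :=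
  exists A : {set 'I_n}, forall x y, e x y -> (x \in A) != (y \in A).

Definition stable n (e : rel 'I_n) (S : {set 'I_n}) : bool :=
  [forall x in S, forall y in S, ~~ e x y].

Definition del_vertex n (S : {set 'I_n}) (f : option 'I_n) : {set 'I_n} :=
  if f is Some v then S :\ v else S.

Definition add_vertex n (T : {set 'I_n}) (a : option 'I_n) : {set 'I_n} :=
  if a is Some u then u |: T else T.

Definition admissible_add n (e : rel 'I_n) (S : {set 'I_n}) (f a : option 'I_n) : bool :=
  (if a is Some u then (u \notin S) && (f != Some u) else true)
  && stable e (add_vertex (del_vertex S f) a).

(* max over admissible additions (None is always admissible when S is stable) *)
Definition recover_value n (e : rel 'I_n) (S : {set 'I_n}) (f : option 'I_n) : nat :=
  \max_(a : option 'I_n | admissible_add e S f a) #|add_vertex (del_vertex S f) a|.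

(* min over deletions f in V u {None}; the index set is nonempty and all
   values are <= n, so the default n.+1 is never the result. *)
Definition robust_value n (e : rel 'I_n) (S : {set 'I_n}) : nat :=
  \big[minn/n.+1]_(f : option 'I_n) recover_value e S f.

Definition robust_optimal n (e : rel 'I_n) (S : {set 'I_n}) : Prop :=
  stable e S /\ forall S' : {set 'I_n}, stable e S' -> robust_value e S' <= robust_value e S.

(* Machine model: deterministic single-tape Turing machines.           *)
(* Tape alphabet 'I_(G+3): 0 = blank, 1 = bit false, 2 = bit true,     *)
(* others are auxiliary symbols. States 'I_(Q+1), start state 0; the   *)
(* machine halts when the transition function returns None.            *)

Inductive move := MoveL | MoveR | Stay.

Record TM := {
  tm_Q : nat;
  tm_G : nat;
  tm_delta : 'I_tm_Q.+1 -> 'I_tm_G.+3 -> option ('I_tm_Q.+1 * 'I_tm_G.+3 * move)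
}.

Section TMSemantics.
Variable M : TM.

Definition sym := 'I_(tm_G M).+3.
Definition blank : sym := inord 0.
Definition bit_sym (b : bool) : sym := inord (if b then 2 else 1).
Definition sym_bit (s : sym) : option bool :=
  if val s == 1 then Some false else if val s == 2 then Some true else None.

(* tape zipper: (cells left of head, nearest first; head cell; cells right) *)
Definition tape := (seq sym * sym * seq sym)%type.
Definition config := ('I_(tm_Q M).+1 * tape)%type.

Definition move_tape (m : move) (t : tape) : tape :=
  let: (l, a, r) := t in
  match m with
  | Stay => t
  | MoveL => if l is x :: l' then (l', x, a :: r) else ([::], blank, a :: r)
  | MoveR => if r is x :: r' then (a :: l, x, r') else (a :: l, blank, [::])
  end.

Definition step (c : config) : option config :=
  let: (q, (l, a, r)) := c in
  match tm_delta q a with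
  | None => None
  | Some (q', b, m) => Some (q', move_tape m (l, b, r))
  end.

Fixpoint exec (k : nat) (c : config) : option config :=
  if k is k'.+1 then obind step (exec k' c) else Some c.

Definition init (w : seq bool) : config :=
  (ord0, match w with
         | [::] => ([::], blank, [::])
         | b :: w' => ([::], bit_sym b, map bit_sym w')
         end).

Fixpoint read_bits (s : seq sym) : seq bool :=
  if s is x :: s' then
    (if sym_bit x is Some b then b :: read_bits s' else [::])
  else [::].

Definition output (c : config) : seq bool :=
  let: (_, (_, a, r)) := c in read_bits (a :: r).

End TMSemantics.

Definition encode_graph n (e : rel 'I_n) : seq bool :=
  [seq e i j | i <- enum 'I_n, j <- enum 'I_n].

Definition decode_set n (o : seq bool) : {set 'I_n} :=
  [set i : 'I_n | nth false o i].

Arguments step M c : clear implicits.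
Arguments exec M k c : clear implicits.
Arguments init M w : clear implicits.
Arguments output M c : clear implicits.

(* Main.v *)
Require Import Defs.
From mathcomp Require Import all_boot zify.
Set Implicit Arguments. Unset Strict Implicit. Unset Printing Implicit Defensive.

(**
Let alpha be the stability number. Every maximum stable set has robust value at least
[alpha - 1], and no stable set has value above [alpha]. Value [alpha] forces every vertex of
a stable set [T] of size [alpha] to have a private neighbour outside [T]; in a bipartite
graph König's theorem gives [n <= 2 alpha], so [n = 2 alpha], all of [T] consists of leaves
and every edge of a perfect matching contains a leaf. Hence it suffices to compute a maximum
stable set that consists of leaves whenever each matching edge contains one.

The matching is built without knowing the bipartition: [level M k] is the set of vertices
reached from the unmatched ones by at most [k] steps from [w] to a mate of a neighbour of [w].
For an unmatched [u] adjacent to a [w] in the lowest possible level, one matches [u] with [w]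
and frees the old mate of [w]; this either enlarges the matching or lowers the level. At the
end the closure of the unmatched vertices is conflict-free; a maximum stable set is obtained
by repeatedly adding a vertex [x] such that neither [x] nor its mate is chosen (a leaf
if possible) and closing again.

All steps are first-order updates of binary relations on the vertices, iterated [n * n] times.
Such a relational program is translated into a loop program on bit arrays of length [m = n * n]
and index variables, where an index is a token placed on a cell; each elementary instruction
is a left-to-right Mealy pass over the tape, and a Turing machine simulates passes
by sweeping back and forth.
*)

(** * Sweeping automata on a single tape *)

Section Reach.
Variable M : TM.

Definition reach k (c c' : config M) := exec M k c = Some c'.

Lemma reach_trans j k c1 c2 c3 :
  reach j c1 c2 -> reach k c2 c3 -> reach (j + k) c1 c3.
Proof.
rewrite /reach => H12; elim: k c3 => [|k IH] c3 /=.
  by move=> [<-]; rewrite addn0.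
rewrite addnS /=; case E: (exec M k c2) => [c|//] /= Hs.
by rewrite (IH _ E).
Qed.

Lemma reach_step c c' : step M c = Some c' -> reach 1 c c'.
Proof. by []. Qed.

Lemma reach_cons k c1 c2 c3 :
  step M c1 = Some c2 -> reach k c2 c3 -> reach k.+1 c1 c3.
Proof. by move=> /reach_step H12 H23; rewrite -add1n; apply: reach_trans H12 H23. Qed.

End Reach.

Section Sweep.
Variable G : finType.

Fixpoint mealy (Q : Type) (f : Q -> G -> Q * G) (q : Q) (w : seq G) : Q * seq G :=
  if w is c :: w' then
    let: (q1, c1) := f q c in let: (q2, w2) := mealy f q1 w' in (q2, c1 :: w2)
  else (q, [::]).

(** One left-to-right pass runs [aut_cell]; at the right end [aut_turn] gives the state of the next
    pass, and [None] ends the run. *)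
Record automaton := Automaton {
  aut_state : finType;
  aut_start : aut_state;
  aut_cell : aut_state -> G -> aut_state * G;
  aut_turn : aut_state -> option aut_state }.

Fixpoint exits (A : automaton) k (q : aut_state A) (w w' : seq G) : Prop :=
  if k is k'.+1 then
    let: (q1, w1) := mealy (@aut_cell A) q w in
    if aut_turn q1 is Some q2 then exits k' q2 w1 w' else k' = 0 /\ w1 = w'
  else False.

Lemma size_mealy Q (f : Q -> G -> Q * G) q w : size (mealy f q w).2 = size w.
Proof.
elim: w q => [|c w IH] q //=; case: (f q c) => q1 c1.
by move: (IH q1); case: (mealy f q1 w) => q2 w2 /= ->.
Qed.

Variables (A : automaton) (inp : bool -> G) (out : G -> option bool).

Definition control : finType := ((aut_state A + aut_state A) + bool)%type.
Definition Going (q : aut_state A) : control := inl (inl q).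
Definition Returning (q : aut_state A) : control := inl (inr q).
Definition Printing : control := inr false.
Definition Halted : control := inr true.

Definition tm_sym := 'I_#|G|.+3.
Definition tm_state := 'I_#|control|.+1.
Definition enc (c : G) : tm_sym := @rshift 3 #|G| (enum_rank c).
(** Symbols below 3 are the blank and the bits; during passes a symbol that decodes to no cell marks
    an end of the word. *)
Definition dec (s : tm_sym) : option G :=
  if @split 3 #|G| s is inr i then Some (enum_val i) else None.
Definition bitS (b : bool) : tm_sym := inord (if b then 2 else 1).
Definition blankS : tm_sym := inord 0.
Definition printS (c : G) : tm_sym := if out c is Some b then bitS b else blankS.
(** State [ord0] is kept for reading the input, hence the shift by one. *)
Definition st (p : control) : tm_state := lift ord0 (enum_rank p).

(** State [ord0] turns input bits into cells, [Going] performs a pass, [Returning] walks back to the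
    left end, and [Printing] is the last walk back, writing the output. *)
Definition sweep_delta (s : tm_state) (a : tm_sym) : option (tm_state * tm_sym * move) :=
  if unlift ord0 s is Some i then
    match enum_val i, dec a with
    | inl (inl q), Some c =>
        let: (q', c') := aut_cell q c in Some (st (Going q'), enc c', MoveR)
    | inl (inl q), None =>
        Some (st (if aut_turn q is Some q' then Returning q' else Printing), a, MoveL)
    | inl (inr q), Some c => Some (s, a, MoveL)
    | inl (inr q), None => Some (st (Going q), a, MoveR)
    | inr false, Some c => Some (s, printS c, MoveL)
    | inr false, None => Some (st Halted, a, MoveR)
    | inr true, _ => None
    end
  else
    if val a == 1 then Some (s, enc (inp false), MoveR)
    else if val a == 2 then Some (s, enc (inp true), MoveR)
    else Some (st (Returning (aut_start A)), a, MoveL).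

Definition sweep_tm : TM :=
  {| tm_Q := #|control|; tm_G := #|G|; tm_delta := sweep_delta |}.

Lemma encK c : dec (enc c) = Some c.
Proof.
rewrite /dec /enc -[rshift _ _]/(unsplit (inr (enum_rank c))) unsplitK.
by rewrite enum_rankK.
Qed.

Lemma decS (i : tm_sym) : i < 3 -> dec i = None.
Proof.
move=> i3; rewrite /dec; case: splitP => // j Ej.
by move: i3; rewrite Ej.
Qed.

Lemma dec_blank : dec blankS = None.
Proof. by apply: decS; rewrite inordK. Qed.

Lemma unlift_st p : unlift ord0 (st p) = Some (enum_rank p).
Proof. by rewrite liftK. Qed.

Definition ztape (l r : seq tm_sym) : tape sweep_tm := (l, head blankS r, behead r).
Definition ltape (l r : seq tm_sym) : tape sweep_tm := (behead l, head blankS l, r).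

Lemma moveR_ztape l a r : move_tape MoveR ((l, a, r) : tape sweep_tm) = ztape (a :: l) r.
Proof. by case: r. Qed.

Lemma moveL_ltape l a r : move_tape MoveL ((l, a, r) : tape sweep_tm) = ltape l (a :: r).
Proof. by case: l. Qed.

Definition conf (p : control) (t : tape sweep_tm) : config sweep_tm := (st p, t).

Lemma step_conf p l a r : step sweep_tm (conf p (l, a, r)) =
  if sweep_delta (st p) a is Some (q', b, m)
  then Some (q', move_tape m ((l, b, r) : tape sweep_tm)) else None.
Proof. by []. Qed.

Lemma delta_st p a : sweep_delta (st p) a =
  match p, dec a with
  | inl (inl q), Some c =>
      let: (q', c') := aut_cell q c in Some (st (Going q'), enc c', MoveR)
  | inl (inl q), None =>
      Some (st (if aut_turn q is Some q' then Returning q' else Printing), a, MoveL)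
  | inl (inr q), Some c => Some (st p, a, MoveL)
  | inl (inr q), None => Some (st (Going q), a, MoveR)
  | inr false, Some c => Some (st p, printS c, MoveL)
  | inr false, None => Some (st Halted, a, MoveR)
  | inr true, _ => None
  end.
Proof. by rewrite /sweep_delta unlift_st enum_rankK. Qed.

Lemma going_run q w l r :
  let: (q', w') := mealy (@aut_cell A) q w in
  reach (size w) (conf (Going q) (ztape l (map enc w ++ r)))
    (conf (Going q') (ztape (rev (map enc w') ++ l) r)).
Proof.
elim: w q l => [|c w IH] q l //=.
case Ec: (aut_cell q c) => [q1 c1].
move: (IH q1 (enc c1 :: l)); case: (mealy _ q1 w) => q2 w2 H.
apply: (reach_cons (c2 := conf (Going q1) (ztape (enc c1 :: l) (map enc w ++ r)))).
  rewrite [map enc _ ++ _]/= step_conf delta_st encK /Going Ec.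
  by rewrite moveR_ztape.
by rewrite /= rev_cons cat_rcons.
Qed.

Lemma returning_run q u l r :
  reach (size u) (conf (Returning q) (ltape (map enc u ++ l) r))
    (conf (Returning q) (ltape l (rev (map enc u) ++ r))).
Proof.
elim: u r => [|c u IH] r //=.
apply: (reach_cons (c2 := conf (Returning q) (ltape (map enc u ++ l) (enc c :: r)))).
  rewrite step_conf delta_st encK /Returning /Printing.
  by rewrite moveL_ltape.
by rewrite rev_cons cat_rcons; apply: IH.
Qed.

Lemma printing_run u l r :
  reach (size u) (conf Printing (ltape (map enc u ++ l) r))
    (conf Printing (ltape l (rev (map printS u) ++ r))).
Proof.
elim: u r => [|c u IH] r //=.
apply: (reach_cons (c2 := conf Printing (ltape (map enc u ++ l) (printS c :: r)))).
  rewrite step_conf delta_st encK /Returning /Printing.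
  by rewrite moveL_ltape.
by rewrite rev_cons cat_rcons; apply: IH.
Qed.

(** The first visit to an end leaves an explicit blank there, so an end of the word is an empty list
    or one that starts with a blank. *)
Definition blank_headed (s : seq tm_sym) := head blankS s == blankS.

Lemma return_at_left q l r : blank_headed l ->
  step sweep_tm (conf (Returning q) (ltape l r)) =
    Some (conf (Going q) (ztape (blankS :: behead l) r)).
Proof.
move=> /eqP hl; rewrite step_conf delta_st hl dec_blank /Returning.
by rewrite moveR_ztape.
Qed.

(** A pass costs [size w] moves each way and two turns, whence the factor [(size w).+1.*2]. *)
Lemma exits_reach k q w w' l r :
  blank_headed l -> blank_headed r -> exits k q w w' ->
  exists l' r', reach (k * (size w).+1.*2) (conf (Going q) (ztape l (map enc w ++ r)))
    (conf Halted (ztape l' (map printS w' ++ blankS :: r'))).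
Proof.
elim: k q w l r => [|k IH] q w l r hl hr //=.
case Em: (mealy _ q w) => [q1 w1].
have sz1 : size w1 = size w by rewrite -(size_mealy (@aut_cell A) q w) Em.
move: (going_run q w l r); rewrite Em => Hgo.
set t1 := ztape (rev (map enc w1) ++ l) r in Hgo.
have Hturn : step sweep_tm (conf (Going q1) t1) =
   Some (conf (if aut_turn q1 is Some q' then Returning q' else Printing)
     (ltape (map enc (rev w1) ++ l) (blankS :: behead r))).
  rewrite step_conf delta_st (eqP hr) dec_blank /Going.
  by rewrite moveL_ltape map_rev.
case Et: (aut_turn q1) => [q2|].
  move=> /(IH _ _ (blankS :: behead l) (blankS :: behead r) (eqxx _) (eqxx _)).
  move=> [l' [r' Hrec]]; exists l', r'.
  rewrite Et in Hturn.
  have Hback := returning_run q2 (rev w1) l (blankS :: behead r).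
  rewrite map_rev revK size_rev in Hback.
  have Hgo2 := return_at_left q2 (map enc w1 ++ blankS :: behead r) hl.
  rewrite map_rev in Hturn.
  have := reach_trans (reach_trans Hgo (reach_cons Hturn Hback)) (reach_cons Hgo2 Hrec).
  rewrite sz1; congr (reach _ _ _); lia.
move=> [-> <-]; rewrite Et in Hturn.
have Hp := printing_run (rev w1) l (blankS :: behead r).
rewrite !map_rev revK size_rev in Hp; rewrite map_rev in Hturn.
have Hfin : step sweep_tm (conf Printing (ltape l (map printS w1 ++ blankS :: behead r))) =
    Some (conf Halted (ztape (blankS :: behead l) (map printS w1 ++ blankS :: behead r))).
  by rewrite step_conf delta_st (eqP hl) dec_blank /Printing moveR_ztape.
exists (blankS :: behead l), (behead r).
have := reach_trans Hgo (reach_cons Hturn (reach_trans Hp (reach_step Hfin))).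
rewrite sz1; congr (reach _ _ _); lia.
Qed.

Lemma bitSE b : bitS b = (if b then 2 else 1) :> nat.
Proof. by rewrite /bitS inordK //; case: b. Qed.

Lemma step_start l a r : step sweep_tm (ord0, (l, a, r)) =
  if a == 1 :> nat then Some (ord0, move_tape MoveR ((l, enc (inp false), r) : tape sweep_tm))
  else if a == 2 :> nat then Some (ord0, move_tape MoveR ((l, enc (inp true), r) : tape sweep_tm))
  else Some (conf (Returning (aut_start A)) (move_tape MoveL ((l, a, r) : tape sweep_tm))).
Proof.
rewrite /step -/sweep_delta /= /sweep_delta unlift_none /=.
by case: ifP => // _; case: ifP.
Qed.

Lemma reading_run w l :
  reach (size w) ((ord0, ztape l (map bitS w)) : config sweep_tm)
    (ord0, ztape (rev (map enc (map inp w)) ++ l) [::]).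
Proof.
elim: w l => [|b w IH] l //=.
apply: (reach_cons (c2 := (ord0, ztape (enc (inp b) :: l) (map bitS w)))).
  by rewrite step_start /= bitSE; case: b; rewrite -moveR_ztape.
by rewrite rev_cons cat_rcons; apply: IH.
Qed.

Lemma init_ztape w : init sweep_tm w = (ord0, ztape [::] (map bitS w)).
Proof. by case: w. Qed.

Fixpoint printed (w : seq G) : seq bool :=
  if w is c :: w' then if out c is Some b then b :: printed w' else [::] else [::].

Lemma sym_bitS b : @sym_bit sweep_tm (bitS b) = Some b.
Proof. by rewrite /sym_bit [val _]bitSE; case: b. Qed.

Lemma sym_bit_blank : @sym_bit sweep_tm blankS = None.
Proof. by rewrite /sym_bit /= inordK. Qed.

Lemma output_halted l w r :
  output sweep_tm (conf Halted (ztape l (map printS w ++ blankS :: r))) = printed w.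
Proof.
rewrite /output /ztape /conf.
transitivity (@read_bits sweep_tm (map printS w ++ blankS :: r)); first by case: w.
elim: w => [|c w IH] /=; first by rewrite sym_bit_blank.
by rewrite /printS; case: (out c) => [b|]; rewrite ?sym_bitS ?sym_bit_blank ?IH.
Qed.

(** Reading the input and coming back takes as long as one more pass. *)
Lemma sweep_tm_correct k w w' :
  exits k (aut_start A) (map inp w) w' ->
  exists t c, [/\ t <= (k.+1) * (size w).+1.*2, exec sweep_tm t (init sweep_tm w) = Some c,
    step sweep_tm c = None & output sweep_tm c = printed w'].
Proof.
move=> Hex.
have Hread := reading_run w [::].
have [l' [r' Hrun]] := exits_reach (l := [:: blankS]) (r := [:: blankS]) (eqxx _) (eqxx _) Hex.
set c := conf Halted _ in Hrun.
rewrite cats0 in Hread.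
have Hturn : step sweep_tm (ord0, ztape (rev (map enc (map inp w))) [::]) =
   Some (conf (Returning (aut_start A)) (ltape (map enc (rev (map inp w)) ++ [::]) [:: blankS])).
  by rewrite step_start inordK // moveL_ltape map_rev cats0.
have Hback := returning_run (aut_start A) (rev (map inp w)) [::] [:: blankS].
have Hgo := return_at_left (aut_start A) (rev (map enc (rev (map inp w))) ++ [:: blankS])
  (eqxx _ : blank_headed [::]).
have Erev : rev (map enc (rev (map inp w))) = map enc (map inp w) by rewrite map_rev revK.
rewrite Erev in Hback Hgo.
rewrite size_rev size_map in Hback.
have Hall := reach_trans Hread (reach_cons Hturn (reach_trans Hback (reach_cons Hgo Hrun))).
exists (size w + (size w + (k * (size (map inp w)).+1.*2).+1).+1), c.
split; first by rewrite size_map; lia.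
- by rewrite init_ztape; apply: Hall.
- by rewrite /c step_conf delta_st.
- exact: output_halted.
Qed.

End Sweep.

(** * Loop programs as sweeping automata *)

Section Combinators.
Variable G : finType.
Implicit Types (A B : automaton G) (w : seq G).

Lemma mealy_lift (Q1 Q2 : Type) (h : Q1 -> Q2) (f1 : Q1 -> G -> Q1 * G)
    (f2 : Q2 -> G -> Q2 * G) :
  (forall q c, f2 (h q) c = (h (f1 q c).1, (f1 q c).2)) ->
  forall w q, mealy f2 (h q) w = (h (mealy f1 q w).1, (mealy f1 q w).2).
Proof.
move=> hf; elim=> [|c w IH] q //=; rewrite hf; case: (f1 q c) => q1 c1 /=.
by rewrite IH; case: (mealy f1 q1 w).
Qed.

Lemma mealy_read (Q1 Q2 : Type) (h : Q1 -> Q2) (g : Q1 -> G -> Q1) (f : Q2 -> G -> Q2 * G) :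
  (forall q c, f (h q) c = (h (g q c), c)) ->
  forall w q, mealy f (h q) w = (h (foldl g q w), w).
Proof. by move=> hf; elim=> [|c w IH] q //=; rewrite hf IH. Qed.

Lemma mealy_rcons Q (f : Q -> G -> Q * G) q w c :
  (mealy f q (rcons w c)).1 = (f (mealy f q w).1 c).1.
Proof.
elim: w q => [|c' w IH] q /=; first by case: (f q c).
case: (f q c') => q1 c1 /=; move: (IH q1).
by case: (mealy f q1 (rcons w c)); case: (mealy f q1 w).
Qed.

Lemma nth_mealy Q (f : Q -> G -> Q * G) c0 q w p : p < size w ->
  nth c0 (mealy f q w).2 p = (f (mealy f q (take p w)).1 (nth c0 w p)).2.
Proof.
elim: w q p => [|c w IH] q [|p] //= pw; case Ef: (f q c) => [q1 c1].
  by case: (mealy f q1 w).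
move: (IH q1 p pw); case: (mealy f q1 w) => q2 w2 /= ->.
by case: (mealy f q1 (take p w)).
Qed.

Lemma exitsS A k (q : aut_state A) w w' : exits k.+1 q w w' =
  let: (q1, w1) := mealy (@aut_cell _ A) q w in
  if aut_turn q1 is Some q2 then exits k q2 w1 w' else k = 0 /\ w1 = w'.
Proof. by []. Qed.

(** A run of [A] is replayed inside [B] through [h]; [x] is what [B] does where [A] would halt: halt
    as well, or begin a pass in the given state. *)
Lemma exits_embed A B (h : aut_state A -> aut_state B) (x : option (aut_state B)) :
  (forall q c, aut_cell (h q) c = (h (aut_cell q c).1, (aut_cell q c).2)) ->
  (forall q, aut_turn (h q) = if aut_turn q is Some q' then Some (h q') else x) ->
  forall k l q w w1 w2, exits k q w w1 ->
  (if x is Some q' then exits l q' w1 w2 else l = 0 /\ w1 = w2) ->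
  exits (k + l) (h q) w w2.
Proof.
move=> hc ht; elim=> [|k IH] l q w w1 w2 //=.
rewrite (mealy_lift hc); case: (mealy _ q w) => q1 w1' /=.
rewrite ht; case: (aut_turn q1) => [q2|]; first exact: IH.
by move=> [-> ->]; case: x {ht IH}.
Qed.

Definition aut_mealy (R : finType) (r0 : R) (f : R -> G -> R * G) : automaton G :=
  Automaton r0 f (fun _ => None).

Lemma exits_mealy (R : finType) (r0 : R) f w :
  exits (A := aut_mealy r0 f) 1 r0 w (mealy f r0 w).2.
Proof. by rewrite /=; case: (mealy f r0 w). Qed.

Definition aut_seq A B : automaton G :=
  @Automaton G (aut_state A + aut_state B)%type (inl (aut_start A))
    (fun q c => match q with
      | inl q => (inl (aut_cell q c).1, (aut_cell q c).2)
      | inr q => (inr (aut_cell q c).1, (aut_cell q c).2) end)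
    (fun q => match q with
      | inl q => Some (if aut_turn q is Some q' then inl q' else inr (aut_start B))
      | inr q => omap inr (aut_turn q) end).

Lemma exits_seq A B k l w w1 w2 :
  exits k (aut_start A) w w1 -> exits l (aut_start B) w1 w2 ->
  exits (k + l) (aut_start (aut_seq A B)) w w2.
Proof.
move=> HA HB.
apply: (exits_embed (h := inl : _ -> aut_state (aut_seq A B)) (x := Some (inr (aut_start B)))
  _ _ HA) => //.
  by move=> q /=; case: (aut_turn q).
rewrite -[l]addn0.
apply: (exits_embed (h := inr : _ -> aut_state (aut_seq A B)) (x := None) _ _ HB) => //.
Qed.

Section Tests.
Variables (R : finType) (r0 : R) (g : R -> G -> R) (ok : R -> bool).

(** The first pass only reads, and its final state selects the automaton that takes over. *)
Definition aut_if A B : automaton G :=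
  @Automaton G (R + (aut_state A + aut_state B))%type (inl r0)
    (fun q c => match q with
      | inl r => (inl (g r c), c)
      | inr (inl q) => (inr (inl (aut_cell q c).1), (aut_cell q c).2)
      | inr (inr q) => (inr (inr (aut_cell q c).1), (aut_cell q c).2) end)
    (fun q => match q with
      | inl r => Some (inr (if ok r then inl (aut_start A) else inr (aut_start B)))
      | inr (inl q) => omap (fun q => inr (inl q)) (aut_turn q)
      | inr (inr q) => omap (fun q => inr (inr q)) (aut_turn q) end).

Lemma exits_if A B k w w' :
  (if ok (foldl g r0 w) then exits k (aut_start A) w w' else exits k (aut_start B) w w') ->
  exits k.+1 (aut_start (aut_if A B)) w w'.
Proof.
rewrite exitsS (mealy_read (h := inl) (g := g)) //.
rewrite [aut_turn _]/=; case: (ok _) => H; rewrite -[k]addn0.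
  apply: (exits_embed (h := (fun q => inr (inl q)) : _ -> aut_state (aut_if A B)) (x := None)
    _ _ H) => //.
apply: (exits_embed (h := (fun q => inr (inr q)) : _ -> aut_state (aut_if A B)) (x := None)
  _ _ H) => //.
Qed.

Definition aut_while A : automaton G :=
  @Automaton G (R + aut_state A)%type (inl r0)
    (fun q c => match q with
      | inl r => (inl (g r c), c)
      | inr q => (inr (aut_cell q c).1, (aut_cell q c).2) end)
    (fun q => match q with
      | inl r => if ok r then Some (inr (aut_start A)) else None
      | inr q => Some (if aut_turn q is Some q' then inr q' else inl r0) end).

Lemma exits_while_stop A w :
  ~~ ok (foldl g r0 w) -> exits 1 (aut_start (aut_while A)) w w.
Proof.
by move=> no; rewrite /= (mealy_read (h := inl) (g := g)) // (negbTE no).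
Qed.

Lemma exits_while_step A k l w w1 w2 :
  ok (foldl g r0 w) -> exits k (aut_start A) w w1 ->
  exits l (aut_start (aut_while A)) w1 w2 ->
  exits (k + l).+1 (aut_start (aut_while A)) w w2.
Proof.
move=> yes HA HB.
rewrite exitsS (mealy_read (h := inl) (g := g)) // [aut_turn _]/= yes.
apply: (exits_embed (h := inr : _ -> aut_state (aut_while A)) (x := Some (inl r0)) _ _ HA) => //.
by move=> q /=; case: (aut_turn q).
Qed.

End Tests.
End Combinators.

(** * The loop language: semantics, cost and compilation *)

Section Language.
Variables V K : finType.

Inductive prog :=
  | Skip
  | Zero of V
  | Inc of V
  | Write of K & V & bool
  | Seq of prog & prog
  | IfBit of K & V & prog & prog
  | IfLt of V & V & prog & prog
  | For of V & prog.

Record store := Store { var : V -> nat; arr : K -> nat -> bool }.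

Definition setv s v x := Store (fun u => if u == v then x else var s u) (arr s).
Definition seta s a i b :=
  Store (var s) (fun c j => if (c == a) && (j == i) then b else arr s c j).

Section Eval.
Variable m : nat.

(** The cap at [m] matches a token that falls off the right end of the tape. *)
Definition incv v s := setv s v (minn (var s v).+1 m).

Fixpoint eval (p : prog) (s : store) : store :=
  match p with
  | Skip => s
  | Zero v => setv s v 0
  | Inc v => incv v s
  | Write a v b => seta s a (var s v) b
  | Seq p q => eval q (eval p s)
  | IfBit a v p q => if (var s v < m) && arr s a (var s v) then eval p s else eval q s
  | IfLt v u p q => if var s v < var s u then eval p s else eval q s
  | For v p => iter m (fun s => incv v (eval p s)) (setv s v 0)
  end.

(** An upper bound on the number of passes. A round of [For] pays for its body, the increment and
    the test; the last [2] pays for zeroing and the final test. *)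
Fixpoint cost (p : prog) : nat :=
  match p with
  | Seq p q => cost p + cost q
  | IfBit _ _ p q | IfLt _ _ p q => (cost p + cost q).+1
  | For v p => m * (cost p).+2 + 2
  | _ => 1
  end.

End Eval.

Fixpoint assigned (p : prog) : seq V :=
  match p with
  | Zero v | Inc v => [:: v]
  | Seq p q | IfBit _ _ p q | IfLt _ _ p q => assigned p ++ assigned q
  | For v p => v :: assigned p
  | _ => [::]
  end.

(** A compiled loop stops once its token has left the tape, so the body must not move that token. *)
Fixpoint wf (p : prog) : bool :=
  match p with
  | Seq p q | IfBit _ _ p q | IfLt _ _ p q => wf p && wf q
  | For v p => (v \notin assigned p) && wf p
  | _ => true
  end.

Lemma eval_frame m p v s : v \notin assigned p -> var (eval m p s) v = var s v.
Proof.
elim: p s => //=.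
- by move=> u s; rewrite inE => /negbTE ->.
- by move=> u s; rewrite inE => /negbTE ->.
- by move=> p IHp q IHq s; rewrite mem_cat negb_or => /andP[vp vq]; rewrite IHq ?IHp.
- by move=> a u p IHp q IHq s; rewrite mem_cat negb_or => /andP[vp vq]; case: ifP; rewrite ?IHq ?IHp.
- by move=> a u p IHp q IHq s; rewrite mem_cat negb_or => /andP[vp vq]; case: ifP; rewrite ?IHq ?IHp.
- move=> u p IH s; rewrite inE negb_or => /andP[/negbTE vu vp].
  by elim: {1}m => [|k IHk] /=; rewrite vu // IH.
Qed.

(** The invariant rule: [P i] describes the store before round [i], when the counter has value
    [i]. *)
Lemma eval_For_ind m v p s (P : nat -> store -> Prop) :
  v \notin assigned p ->
  P 0 (setv s v 0) ->
  (forall i s, i < m -> var s v = i -> P i s -> P i.+1 (incv m v (eval m p s))) ->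
  P m (eval m (For v p) s).
Proof.
move=> vp P0 PS /=.
suff H k : k <= m -> let s' := iter k (fun s => incv m v (eval m p s)) (setv s v 0) in
    var s' v = k /\ P k s' by apply: (H m _).2.
elim: k => [|k IH] km /=; first by rewrite eqxx.
have [Ev Pk] := IH (ltnW km).
rewrite eqxx eval_frame // Ev; split; first by apply/minn_idPl.
exact: PS.
Qed.

Definition cell : finType := ({ffun V -> bool} * {ffun K -> bool})%type.

Definition put_token (c : cell) v b : cell := ([ffun u => if u == v then b else c.1 u], c.2).
Definition put_bit (c : cell) a b : cell := (c.1, [ffun d => if d == a then b else c.2 d]).

(* A variable is the position of its token; a variable without token has value [m]. *)
Definition represents m (w : seq cell) (s : store) := forall c0,
  [/\ size w = m, forall v, var s v <= m,
      forall p v, p < m -> (nth c0 w p).1 v = (p == var s v) &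
      forall p a, p < m -> (nth c0 w p).2 a = arr s a p].

Definition zero_cell v (b : bool) (c : cell) := (false, put_token c v b).
(** The state remembers whether the previous cell held the token, which thus moves one cell to the
    right. *)
Definition inc_cell v (b : bool) (c : cell) := (c.1 v, put_token c v b).
Definition write_cell a v b (_ : unit) (c : cell) := (tt, if c.1 v then put_bit c a b else c).
Definition bit_test a v r (c : cell) := r || c.1 v && c.2 a.
Definition token_test v r (c : cell) := r || c.1 v.
(** The token met first decides. [None] means that neither has been met, so two absent tokens count
    as equal values [m]. *)
Definition lt_test v u (r : option bool) (c : cell) :=
  if r is Some _ then r else
  if c.1 v then Some (~~ c.1 u) else if c.1 u then Some false else None.

Fixpoint compile (p : prog) : automaton cell :=
  match p with
  | Skip => aut_mealy tt (fun _ c => (tt, c))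
  | Zero v => aut_mealy true (zero_cell v)
  | Inc v => aut_mealy false (inc_cell v)
  | Write a v b => aut_mealy tt (write_cell a v b)
  | Seq p q => aut_seq (compile p) (compile q)
  | IfBit a v p q => aut_if false (bit_test a v) id (compile p) (compile q)
  | IfLt v u p q => aut_if None (lt_test v u) (pred1 (Some true)) (compile p) (compile q)
  | For v p => aut_seq (aut_mealy true (zero_cell v))
      (aut_while false (token_test v) id
        (aut_seq (compile p) (aut_mealy false (inc_cell v))))
  end.

(** [F p] is a closed form for the state of a reading pass after [p] cells. *)
Lemma foldl_prefix (R : Type) (g : R -> cell -> R) r0 (F : nat -> R) c0 w :
  F 0 = r0 -> (forall p, p < size w -> g (F p) (nth c0 w p) = F p.+1) ->
  foldl g r0 w = F (size w).
Proof.
move=> F0 FS.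
suff H p : p <= size w -> foldl g r0 (take p w) = F p by rewrite -H // take_size.
elim: p => [|p IH] pw; first by rewrite take0 F0.
by rewrite (take_nth c0) // -cats1 foldl_cat /= IH ?FS // ltnW.
Qed.

Let c00 : cell := ([ffun => false], [ffun => false]).

Lemma represents_nth m (w : seq cell) s (c0 : cell) :
  [/\ size w = m, forall v, var s v <= m,
      forall p v, p < m -> (nth c0 w p).1 v = (p == var s v) &
      forall p a, p < m -> (nth c0 w p).2 a = arr s a p] -> represents m w s.
Proof.
move=> [sz le ev ea] c1; split=> // p x pm; rewrite (set_nth_default c0) ?sz //.
  exact: ev.
exact: ea.
Qed.

Lemma represents_zero m w s v :
  represents m w s -> represents m (mealy (zero_cell v) true w).2 (setv s v 0).
Proof.
move=> /(_ c00)[sz le ev ea]; apply: (represents_nth (c0 := c00)).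
have st p : p <= size w -> (mealy (zero_cell v) true (take p w)).1 = (p == 0).
  by case: p => [|p] pw; [rewrite take0 | rewrite (take_nth c00) // mealy_rcons].
split; first by rewrite size_mealy.
- by move=> u /=; case: eqP.
- move=> p u pm; rewrite nth_mealy ?sz //= st ?sz ?(ltnW pm) // ffunE /=.
  by case: eqP => // _; apply: ev.
- by move=> p a pm; rewrite nth_mealy ?sz //=; apply: ea.
Qed.

Lemma represents_inc m w s v :
  represents m w s -> represents m (mealy (inc_cell v) false w).2 (incv m v s).
Proof.
move=> /(_ c00)[sz le ev ea]; apply: (represents_nth (c0 := c00)).
have st p : p <= size w -> (mealy (inc_cell v) false (take p w)).1 = (p == (var s v).+1).
  case: p => [|p] pw; first by rewrite take0.
  by rewrite (take_nth c00) // mealy_rcons /= ev -?sz.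
split; first by rewrite size_mealy.
- by move=> u /=; case: eqP => // _; rewrite geq_minr.
- move=> p u pm; rewrite nth_mealy ?sz //= st ?sz ?(ltnW pm) // ffunE /=.
  case: eqP => [_|_]; last exact: ev.
  have := le v; lia.
- by move=> p a pm; rewrite nth_mealy ?sz //=; apply: ea.
Qed.

Lemma represents_write m w s a v b :
  represents m w s -> represents m (mealy (write_cell a v b) tt w).2 (seta s a (var s v) b).
Proof.
move=> /(_ c00)[sz le ev ea]; apply: (represents_nth (c0 := c00)); split=> //.
- by rewrite size_mealy.
- move=> p u pm; rewrite nth_mealy ?sz //=.
  by case: ifP => _; rewrite /= ev.
- move=> p d pm; rewrite nth_mealy ?sz //= ev //.
  case: eqP => [_|_] /=; last by rewrite andbF ea.
  by rewrite ffunE andbT; case: eqP => //; rewrite ea.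
Qed.

Lemma bit_testE m w s a v : represents m w s ->
  foldl (bit_test a v) false w = (var s v < m) && arr s a (var s v).
Proof.
move=> /(_ c00)[sz le ev ea].
rewrite (foldl_prefix (F := fun p => (var s v < p) && arr s a (var s v)) (c0 := c00)) ?sz //.
move=> p pm; rewrite /bit_test ev // ea // ltnS [var s v <= p]leq_eqVlt eq_sym.
by case: eqP => [->|_] /=; rewrite ?ltnn ?orbF.
Qed.

Lemma token_testE m w s v : represents m w s ->
  foldl (token_test v) false w = (var s v < m).
Proof.
move=> /(_ c00)[sz le ev ea].
rewrite (foldl_prefix (F := fun p => var s v < p) (c0 := c00)) ?sz //.
by move=> p pm; rewrite /token_test ev // ltnS [var s v <= p]leq_eqVlt eq_sym orbC.
Qed.

Lemma lt_testE m w s v u : represents m w s ->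
  (foldl (lt_test v u) None w == Some true) = (var s v < var s u).
Proof.
move=> /(_ c00)[sz le ev ea].
rewrite (foldl_prefix (F := fun p => if minn (var s v) (var s u) < p
  then Some (var s v < var s u) else None) (c0 := c00)) ?sz //.
  case: ifP => [_|]; first by case: ltnP.
  by have := le v; have := le u => *; apply/esym/negbTE; lia.
move=> p pm; rewrite /lt_test !ev //; case: ifP => [H1|H1].
  by rewrite ifT // ltnW.
case: eqP => [<-|nv]; last case: eqP => [<-|nu].
- case: ifP => [_|]; last lia.
  by congr Some; lia.
- case: ifP => [_|]; last lia.
  by congr Some; lia.
- by case: ifP => //; lia.
Qed.

Lemma compile_correct m p w s : wf p -> represents m w s ->
  exists k w', [/\ k <= cost m p, exits k (aut_start (compile p)) w w' &
    represents m w' (eval m p s)].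
Proof.
elim: p w s => /=.
- move=> w s _ r; exists 1, w; split=> //.
  by rewrite /= (mealy_read (h := id) (g := fun _ _ => tt)) //; case.
- by move=> v w s _ r; exists 1, (mealy (zero_cell v) true w).2; split=> //;
    [exact: exits_mealy | exact: represents_zero].
- by move=> v w s _ r; exists 1, (mealy (inc_cell v) false w).2; split=> //;
    [exact: exits_mealy | exact: represents_inc].
- by move=> a v b w s _ r; exists 1, (mealy (write_cell a v b) tt w).2; split=> //;
    [exact: exits_mealy | exact: represents_write].
- move=> p IHp q IHq w s /andP[wp wq] r.
  have [k [w1 [kc e1 r1]]] := IHp _ _ wp r; have [l [w2 [lc e2 r2]]] := IHq _ _ wq r1.
  by exists (k + l), w2; split=> //; [exact: leq_add | exact: exits_seq e1 e2].
- move=> a v p IHp q IHq w s /andP[wp wq] r; case: ifP => t.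
    have [k [w1 [kc e1 r1]]] := IHp _ _ wp r.
    exists k.+1, w1; split=> //; first lia.
    by apply: exits_if; rewrite /= (bit_testE _ _ r) t.
  have [k [w1 [kc e1 r1]]] := IHq _ _ wq r.
  exists k.+1, w1; split=> //; first lia.
  by apply: exits_if; rewrite /= (bit_testE _ _ r) t.
- move=> v u p IHp q IHq w s /andP[wp wq] r; case: ifP => t.
    have [k [w1 [kc e1 r1]]] := IHp _ _ wp r.
    exists k.+1, w1; split=> //; first lia.
    by apply: exits_if; rewrite /= (lt_testE _ _ r) t.
  have [k [w1 [kc e1 r1]]] := IHq _ _ wq r.
  exists k.+1, w1; split=> //; first lia.
  by apply: exits_if; rewrite /= (lt_testE _ _ r) t.
- move=> v p IH w s /andP[vp wp] r.
  have r0 := represents_zero v r.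
  have e0 := exits_mealy (true : bool) (zero_cell v) w.
  set w0 := (mealy _ _ _).2 in r0 e0; set s0 := setv s v 0 in r0 *.
  (* Induction on the number [j] of rounds left, while the counter stands at [m - j]. *)
  have Hloop : forall j w s, represents m w s -> j <= m -> var s v = m - j ->
      exists k w', [/\ k <= j * (cost m p).+2 + 1,
        exits k (aut_start (aut_while false (token_test v) id
          (aut_seq (compile p) (aut_mealy false (inc_cell v))))) w w' &
        represents m w' (iter j (fun s => incv m v (eval m p s)) s)].
    elim=> [|j IHj] w1 s1 r1 jm Ev.
      exists 1, w1; split=> //; apply: exits_while_stop.
      by rewrite (token_testE _ r1) Ev /=; lia.
    have [k1 [w2 [k1c e1 r2]]] := IH _ _ wp r1.
    have r3 := represents_inc v r2.
    have e3 := exits_mealy (false : bool) (inc_cell v) w2.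
    have [|k2 [w4 [k2c e4 r4]]] := IHj _ _ r3 (ltnW jm).
      by rewrite /= eqxx eval_frame // Ev; lia.
    exists ((k1 + 1 + k2).+1), w4; split; first by nia.
      apply: exits_while_step (exits_seq e1 e3) e4.
      by rewrite (token_testE _ r1) Ev /=; lia.
    by rewrite iterSr.
  have [|k [w' [kc e r']]] := Hloop m _ _ r0 (leqnn m).
    by rewrite /= eqxx subnn.
  by exists (1 + k), w'; split=> //; [lia | exact: exits_seq e0 e].
Qed.

End Language.

(** * Relational programs as loop programs *)

(** The base [m + 2] is at least 2, so sums and the factor [m] of a loop are absorbed by raising the
    exponent. *)
Lemma cost_poly V K (p : prog V K) : exists c, forall m, cost m p <= (m + 2) ^ c.
Proof.
have le1 c m : 0 < (m + 2) ^ c by rewrite expn_gt0 addn2.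
have add2 a b m : (m + 2) ^ a + (m + 2) ^ b + 1 <= (m + 2) ^ (a + b + 2).
  rewrite !expnD; have := le1 a m; have := le1 b m.
  move: ((m + 2) ^ a) ((m + 2) ^ b) => x y; nia.
elim: p => /=; try by [move=> *; exists 0].
- move=> p [a Ha] q [b Hb]; exists (a + b + 2) => m.
  by have := add2 a b m; have := Ha m; have := Hb m; lia.
- move=> _ _ p [a Ha] q [b Hb]; exists (a + b + 2) => m.
  by have := add2 a b m; have := Ha m; have := Hb m; lia.
- move=> _ _ p [a Ha] q [b Hb]; exists (a + b + 2) => m.
  by have := add2 a b m; have := Ha m; have := Hb m; lia.
- move=> _ p [a Ha]; exists (a + 3) => m.
  rewrite expnD; have := Ha m; have := le1 a m.
  move: (cost m p) ((m + 2) ^ a) => x y; nia.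
Qed.

(* [vN] holds the order [n], [v0] zero and [vEnd] the tape length; [vX], [vY], [vZ] are the
   variables of formulas, [vP] an address, [vI], [vJ] counters and [vF] a flag; the remaining
   names are for the loops of relational programs. *)
Notation name := 'I_14.
Definition vN : name := @Ordinal 14 0 isT.
Definition v0 : name := @Ordinal 14 1 isT.
Definition vEnd : name := @Ordinal 14 2 isT.
Definition vX : name := @Ordinal 14 3 isT.
Definition vY : name := @Ordinal 14 4 isT.
Definition vZ : name := @Ordinal 14 5 isT.
Definition vP : name := @Ordinal 14 6 isT.
Definition vI : name := @Ordinal 14 7 isT.
Definition vJ : name := @Ordinal 14 8 isT.
Definition vF : name := @Ordinal 14 9 isT.

Reserved Notation "p ;; q" (at level 61, right associativity).

Section Relational.
Variables (K : finType) (tmp : K).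
Notation "p ;; q" := (Seq p q).
Notation prog := (prog name K).
Notation store := (store name K).
Implicit Types (s : store) (a b : K) (v x y : name).

Fixpoint write_free (p : prog) : bool :=
  match p with
  | Write _ _ _ => false
  | Seq p q | IfBit _ _ p q | IfLt _ _ p q => write_free p && write_free q
  | For v p => write_free p
  | _ => true
  end.

Lemma arr_write_free m (q : prog) s : write_free q -> arr (eval m q s) = arr s.
Proof.
elim: q s => //=.
- by move=> p IHp q IHq s /andP[wp wq]; rewrite IHq ?IHp.
- by move=> a u p IHp q IHq s /andP[wp wq]; case: ifP; rewrite ?IHq ?IHp.
- by move=> a u p IHp q IHq s /andP[wp wq]; case: ifP; rewrite ?IHq ?IHp.
- by move=> v p IH s wp; elim: {1}m => [|k IHk] //=; rewrite IH.
Qed.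

(** * Arithmetic on addresses *)

Definition add_to x p : prog := For vJ (IfLt vJ x (Inc _ p) (Skip _ _)).
Definition mul_to x y p : prog := For vI (IfLt vI x (add_to y p) (Skip _ _)).

(** Addition is repeated increment: the guard lets only the rounds below the value of [x] count, and
    the cap at [m] remains in the result. *)
Lemma eval_add_to m x p s : x != vJ -> p != vJ -> x != p ->
  var s x <= m -> var s p <= m ->
  var (eval m (add_to x p) s) p = minn m (var s p + var s x).
Proof.
move=> xJ pJ xp xm pm.
pose P i (s' : store) := var s' x = var s x /\ var s' p = minn m (var s p + minn i (var s x)).
suff [] : P m (eval m (add_to x p) s) by move=> _ ->; congr minn; lia.
apply: eval_For_ind.
- by rewrite /= inE eq_sym.
- by rewrite /P /= (negbTE xJ) (negbTE pJ); split=> //; lia.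
move=> i s' im Ev [Px Pp]; rewrite /P /= (negbTE xJ) (negbTE pJ) Ev Px.
case: ifP => lt /=; last by split=> //; lia.
rewrite eqxx (negbTE xp); split=> //; lia.
Qed.

Lemma eval_mul_to m x y p s : x \notin [:: vI; vJ; p] -> y \notin [:: vI; vJ; p] ->
  p \notin [:: vI; vJ] -> var s x <= m -> var s y <= m -> var s p <= m ->
  var (eval m (mul_to x y p) s) p = minn m (var s p + var s x * var s y).
Proof.
rewrite !inE !negb_or => /and3P[xI xJ xp] /and3P[yI yJ yp] /andP[pI pJ] xm ym pm.
pose P i (s' : store) := [/\ var s' x = var s x, var s' y = var s y &
  var s' p = minn m (var s p + minn i (var s x) * var s y)].
suff [] : P m (eval m (mul_to x y p) s) by move=> _ _ ->; congr minn; congr (_ + _ * _); lia.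
apply: eval_For_ind.
- by rewrite /= !inE (eq_sym vI p) (negbTE pI).
- by rewrite /P /= (negbTE xI) (negbTE yI) (negbTE pI); split=> //; lia.
move=> i s' im Ev [Px Py Pp].
have Hs : P i.+1 (eval m (IfLt vI x (add_to y p) (Skip _ _)) s').
  rewrite /P -[eval _ _ _]/(if var s' vI < var s' x then eval m (add_to y p) s' else s').
  rewrite Ev Px; case: ifP => lt.
    have fr u : u != vJ -> u != p -> var (eval m (add_to y p) s') u = var s' u.
      by move=> uJ up; apply: eval_frame; rewrite /= !inE !negb_or uJ up.
    rewrite (fr x) // (fr y) // eval_add_to ?Py ?Pp ?Px //; last by lia.
    split=> //.
    have -> : minn i.+1 (var s x) = i.+1 by lia.
    have -> : minn i (var s x) = i by lia.
    by rewrite mulSn; lia.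
  split=> //; rewrite Pp; congr (minn m (_ + _ * _)); lia.
by case: Hs => H1 H2 H3; rewrite /P /= (negbTE xI) (negbTE yI) (negbTE pI).
Qed.

(** The row-major address [x * n + y] of an entry, as in the encoding of the graph. *)
Definition addr x y : prog := Zero _ vP ;; mul_to x vN vP ;; add_to y vP.
Definition scratch : seq name := [:: vP; vI; vJ].

Lemma assigned_addr x y : assigned (addr x y) = [:: vP; vI; vJ; vP; vJ; vP].
Proof. by []. Qed.

Lemma addr_frame m x y v s : v \notin scratch -> var (eval m (addr x y) s) v = var s v.
Proof.
by move=> vs; apply: eval_frame; move: vs; rewrite assigned_addr !inE; case: eqP; case: eqP; case: eqP.
Qed.

Lemma arr_addr m x y s : arr (eval m (addr x y) s) = arr s.
Proof. exact: arr_write_free. Qed.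

Lemma index_lt n (i j : 'I_n) : i * n + j < n * n.
Proof. have := ltn_ord i; have := ltn_ord j; nia. Qed.

Lemma eval_addr n x y (i j : 'I_n) s : x \notin scratch -> y \notin scratch ->
  var s vN = n -> var s x = i -> var s y = j ->
  var (eval (n * n) (addr x y) s) vP = i * n + j.
Proof.
move=> xs ys EN Ex Ey; rewrite /addr.
have nn : n <= n * n by have := ltn_ord i; nia.
have lti := ltn_ord i; have ltj := ltn_ord j.
have Hlt := index_lt i j.
move: (xs) (ys); rewrite !inE !negb_or => /and3P[xP xI xJ] /and3P[yP yI yJ].
set m := n * n in nn Hlt *.
set s1 := setv s vP 0.
have E1 : var (eval m (mul_to x vN vP) s1) vP = i * n.
  rewrite eval_mul_to //= ?(negbTE xP) ?EN ?Ex //; try lia.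
  by rewrite !inE !negb_or xI xJ.
rewrite -[eval m _ s]/(eval m (add_to y vP) (eval m (mul_to x vN vP) s1)).
have E2 : var (eval m (mul_to x vN vP) s1) y = j.
  by rewrite eval_frame /= ?(negbTE yP) // !inE !negb_or yI yJ.
by rewrite eval_add_to ?E1 ?E2 //; lia.
Qed.

(** * Formulas over relations and their compilation *)

Inductive ix := IX | IY | IZ.
Inductive fm :=
  | At of K & ix & ix
  | Eq of ix & ix
  | Not of fm
  | And of fm & fm
  | Or of fm & fm.

Definition ix_var i := match i with IX => vX | IY => vY | IZ => vZ end.
Definition ix_sel (T : Type) (x y z : T) i := match i with IX => x | IY => y | IZ => z end.

Definition rels n := K -> 'I_n -> 'I_n -> bool.

Fixpoint feval n (d : rels n) (x y z : 'I_n) (phi : fm) : bool :=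
  match phi with
  | At a i j => d a (ix_sel x y z i) (ix_sel x y z j)
  | Eq i j => ix_sel x y z i == ix_sel x y z j
  | Not f => ~~ feval d x y z f
  | And f g => feval d x y z f && feval d x y z g
  | Or f g => feval d x y z f || feval d x y z g
  end.

Fixpoint tmp_free (phi : fm) : bool :=
  match phi with
  | At a _ _ => a != tmp
  | Eq _ _ => true
  | Not f => tmp_free f
  | And f g | Or f g => tmp_free f && tmp_free g
  end.

(** Formulas become control flow: a connective only rearranges the two continuations, so no truth
    value has to be stored. *)
Fixpoint branch (phi : fm) (p q : prog) : prog :=
  match phi with
  | At a i j => addr (ix_var i) (ix_var j) ;; IfBit a vP p q
  | Eq i j => IfLt (ix_var i) (ix_var j) q (IfLt (ix_var j) (ix_var i) q p)
  | Not f => branch f q p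
  | And f g => branch f (branch g p q) q
  | Or f g => branch f p (branch g p q)
  end.

Definition holds n s (d : rels n) :=
  forall b, b != tmp -> forall i j : 'I_n, arr s b (i * n + j) = d b i j.

Definition agree s s' := arr s' = arr s /\ forall v, v \notin scratch -> var s' v = var s v.

Lemma eval_branch n (d : rels n) (x y z : 'I_n) phi p q s :
  tmp_free phi -> holds s d -> var s vN = n ->
  var s vX = x -> var s vY = y -> var s vZ = z ->
  exists2 s', agree s s' &
    eval (n * n) (branch phi p q) s =
      if feval d x y z phi then eval (n * n) p s' else eval (n * n) q s'.
Proof.
elim: phi p q s => /=.
- move=> a i j p q s atmp hd EN Ex Ey Ez.
  have agr : agree s (eval (n * n) (addr (ix_var i) (ix_var j)) s).
    by split=> [|v vs]; [exact: arr_addr | exact: addr_frame].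
  exists (eval (n * n) (addr (ix_var i) (ix_var j)) s) => //.
  set i' := ix_sel x y z i; set j' := ix_sel x y z j.
  have -> : var (eval (n * n) (addr (ix_var i) (ix_var j)) s) vP = i' * n + j'.
    have sel k : var s (ix_var k) = ix_sel x y z k by case: k.
    have scr k : ix_var k \notin scratch by case: k.
    exact: eval_addr.
  by rewrite index_lt /= agr.1 hd.
- move=> i j p q s _ hd EN Ex Ey Ez; exists s => //.
  have -> : var s (ix_var i) = ix_sel x y z i by case: i.
  have -> : var s (ix_var j) = ix_sel x y z j by case: j.
  rewrite -val_eqE /=; case: ltngtP => //.
- by move=> f IH p q s tf hd EN Ex Ey Ez; have [s' a ->] := IH q p s tf hd EN Ex Ey Ez;
    exists s' => //; case: (feval _ _ _ _ _).
- move=> f IHf g IHg p q s /andP[tf tg] hd EN Ex Ey Ez.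
  have [s' a ->] := IHf (branch g p q) q s tf hd EN Ex Ey Ez.
  case: (feval _ _ _ _ f) => /=; last by exists s'.
  case: a => Ea Ev.
  have [|||||s2 [Ea2 Ev2] ->] := IHg p q s' tg; rewrite ?Ev //.
    by move=> b bt i j; rewrite Ea hd.
  by exists s2 => //; split=> [|v vs]; rewrite ?Ea2 ?Ev2 ?Ev.
- move=> f IHf g IHg p q s /andP[tf tg] hd EN Ex Ey Ez.
  have [s' a ->] := IHf p (branch g p q) s tf hd EN Ex Ey Ez.
  case: (feval _ _ _ _ f) => /=; first by exists s'.
  case: a => Ea Ev.
  have [|||||s2 [Ea2 Ev2] ->] := IHg p q s' tg; rewrite ?Ev //.
    by move=> b bt i j; rewrite Ea hd.
  by exists s2 => //; split=> [|v vs]; rewrite ?Ea2 ?Ev2 ?Ev.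
Qed.

Lemma assigned_branch v phi p q : v \notin scratch ->
  v \notin assigned p -> v \notin assigned q -> v \notin assigned (branch phi p q).
Proof.
move=> vs; elim: phi p q => [a i j|i j|f IH|f IHf g IHg|f IHf g IHg] p q vp vq.
- change (v \notin [:: vP; vI; vJ; vP; vJ; vP] ++ (assigned p ++ assigned q)).
  rewrite !mem_cat !negb_or vp vq !andbT.
  by move: vs; rewrite !inE; case: eqP; case: eqP; case: eqP.
- by rewrite /= !mem_cat !negb_or vp vq.
- exact: IH.
- by apply: IHf => //; apply: IHg.
- by apply: IHf => //; apply: IHg.
Qed.

(** The loop has [n * n] rounds and the guard makes the first [n] effective. [P] must ignore the
    counter, which the idle rounds still change. *)
Lemma eval_For_below n v (p : prog) s (P : nat -> store -> Prop) :
  v \notin assigned p -> vN \notin assigned p -> v != vN -> var s vN = n ->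
  (forall i s t, P i s -> P i (setv s v t)) -> P 0 s ->
  (forall (i : 'I_n) s, var s v = i -> var s vN = n -> P i s -> P i.+1 (eval (n * n) p s)) ->
  P n (eval (n * n) (For v (IfLt v vN p (Skip _ _))) s).
Proof.
move=> vp Np vN' EN Pset P0 PS.
pose Q i (s' : store) := var s' vN = n /\ P (minn i n) s'.
suff [] : Q (n * n) (eval (n * n) (For v (IfLt v vN p (Skip _ _))) s).
  by move=> _; have -> : minn (n * n) n = n by nia.
have N' : (vN == v) = false by rewrite eq_sym; apply/negbTE.
apply: eval_For_ind; first by rewrite /= cats0.
  by split; [rewrite /= N' | rewrite min0n; apply: Pset].
move=> i s' im Ev [EN' Pi]; rewrite /Q [eval _ _ _]/= Ev EN'.
case: ifP => lt; last first.
  split; [by rewrite /= N' | apply: Pset].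
  by have -> : minn i.+1 n = minn i n by lia.
rewrite /= N' eval_frame //; split=> //; apply: Pset.
have -> : minn i.+1 n = i.+1 by lia.
have Ei : minn i n = i by lia.
by apply: (PS (Ordinal lt)) => //=; rewrite -Ei.
Qed.

(** * Updating a relation by a formula *)

Definition try_witness phi : prog :=
  branch phi (addr vX vZ ;; Write tmp vP true) (Skip _ _).
Definition update_entry phi : prog :=
  addr vX vZ ;; Write tmp vP false ;; For vY (IfLt vY vN (try_witness phi) (Skip _ _)).
Definition update_row phi : prog := For vZ (IfLt vZ vN (update_entry phi) (Skip _ _)).
Definition update_all phi : prog := For vX (IfLt vX vN (update_row phi) (Skip _ _)).
Definition copy_tmp a : prog :=
  For vP (IfBit tmp vP (Write a vP true) (Write a vP false)).
(** The new relation is first built in [tmp], so that [phi] may refer to the old contents of [a]. *)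
Definition update a phi : prog := update_all phi ;; copy_tmp a.

(** [IY] is the variable bound by the quantifier; [IX] and [IZ] address the entry. *)
Definition value n (d : rels n) phi (x z : 'I_n) := [exists y, feval d x y z phi].

Lemma frame_try v phi : v \notin scratch -> v \notin assigned (try_witness phi).
Proof.
move=> vs; apply: assigned_branch => //.
by move: vs; rewrite /= !inE; case: eqP; case: eqP; case: eqP.
Qed.

Lemma frame_entry v phi : v \notin vY :: scratch -> v \notin assigned (update_entry phi).
Proof.
rewrite inE negb_or => /andP[vy vs].
rewrite -[assigned _]/([:: vP; vI; vJ; vP; vJ; vP] ++ vY :: (assigned (try_witness phi) ++ [::])).
rewrite cats0 mem_cat inE !negb_or vy frame_try // !andbT.
by move: vs; rewrite /= !inE; case: eqP; case: eqP; case: eqP.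
Qed.

Lemma frame_row v phi : v \notin vZ :: vY :: scratch -> v \notin assigned (update_row phi).
Proof.
rewrite inE negb_or => /andP[vz vs].
by rewrite -[assigned _]/(vZ :: (assigned (update_entry phi) ++ [::])) cats0 inE negb_or vz frame_entry.
Qed.

Lemma eval_update_entry n (d : rels n) (x z : 'I_n) phi s :
  tmp_free phi -> holds s d -> var s vN = n -> var s vX = x -> var s vZ = z ->
  let s' := eval (n * n) (update_entry phi) s in
  (forall b, b != tmp -> arr s' b =1 arr s b) /\
  (forall q, arr s' tmp q = if q == x * n + z then value d phi x z else arr s tmp q).
Proof.
move=> tf hd EN Ex Ez s'.
(* The truth value established by the witnesses tried so far. *)
pose V' k := [exists y : 'I_n, (y < k) && feval d x y z phi].
pose P k (s' : store) := [/\ var s' vX = x, var s' vZ = z,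
  (forall b, b != tmp -> arr s' b =1 arr s b) &
  (forall q, arr s' tmp q = if q == x * n + z then V' k else arr s tmp q)].
set s1 := eval (n * n) (addr vX vZ) s.
have s1P : var s1 vP = x * n + z by apply: eval_addr.
have s1v v : v \notin scratch -> var s1 v = var s v by exact: addr_frame.
have s1a : arr s1 = arr s by exact: arr_addr.
have [] : P n s'; last first.
  move=> _ _ H1 H2; split=> // q; rewrite H2; case: eqP => // _.
  by apply: eq_existsb => y; rewrite ltn_ord.
rewrite /s' -[eval _ _ _]/(eval (n * n) (For vY (IfLt vY vN (try_witness phi) (Skip _ _)))
  (seta s1 tmp (var s1 vP) false)).
apply: eval_For_below; rewrite ?frame_try //=.
- by rewrite s1v.
- split; rewrite /= ?(s1v vX) ?(s1v vZ) //.
    by move=> b bt q; rewrite (negbTE bt) s1a.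
  move=> q; rewrite eqxx s1P /= s1a; case: eqP => // _.
  by apply/esym/negbTE/existsPn => y.
move=> y s2 Ey2 EN2 [Ex2 Ez2 A2 T2].
have hd2 : holds s2 d by move=> b bt i j; rewrite A2 // hd.
have [s3 [Ea3 Ev3] ->] := eval_branch (addr vX vZ ;; Write tmp vP true) (Skip _ _)
  tf hd2 EN2 Ex2 Ey2 Ez2.
have V'S : V' y.+1 = V' y || feval d x y z phi.
  apply/existsP/orP => [[y' /andP[ly f]]|[/existsP[y' /andP[ly f]]|f]].
  - move: ly; rewrite ltnS leq_eqVlt => /orP[/eqP/val_inj E|lt]; first by right; rewrite -E.
    by left; apply/existsP; exists y'; rewrite lt.
  - by exists y'; rewrite f ltnS ltnW.
  - by exists y; rewrite ltnSn.
rewrite /P V'S; case: ifP => _; last first.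
  by rewrite orbF /= (Ev3 vX) // (Ev3 vZ) // Ea3.
rewrite orbT; set s4 := eval (n * n) (addr vX vZ) s3.
have s4P : var s4 vP = x * n + z by apply: eval_addr => //; rewrite Ev3.
have s4v v : v \notin scratch -> var s4 v = var s3 v by exact: addr_frame.
have s4a : arr s4 = arr s3 by exact: arr_addr.
rewrite -[eval _ _ s3]/(seta s4 tmp (var s4 vP) true).
split; rewrite /= ?(s4v vX) ?(s4v vZ) ?(Ev3 vX) ?(Ev3 vZ) //.
  by move=> b bt q; rewrite (negbTE bt) s4a Ea3 A2.
by move=> q; rewrite eqxx s4P s4a Ea3 T2 /=; case: eqP.
Qed.

Lemma eval_update_row n (d : rels n) (x : 'I_n) phi s :
  tmp_free phi -> holds s d -> var s vN = n -> var s vX = x ->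
  let s' := eval (n * n) (update_row phi) s in
  [/\ (forall b, b != tmp -> arr s' b =1 arr s b),
  (forall q, q < x * n -> arr s' tmp q = arr s tmp q) &
  (forall z : 'I_n, arr s' tmp (x * n + z) = value d phi x z)].
Proof.
move=> tf hd EN Ex s'.
pose P k (s' : store) := [/\ var s' vX = x,
  (forall b, b != tmp -> arr s' b =1 arr s b),
  (forall q, q < x * n -> arr s' tmp q = arr s tmp q) &
  (forall z : 'I_n, z < k -> arr s' tmp (x * n + z) = value d phi x z)].
suff [] : P n s' by move=> _ H1 H2 H3; split=> // z; apply: H3.
apply: eval_For_below; rewrite ?frame_entry //.
move=> z s2 Ez2 EN2 [Ex2 A2 T2 U2].
have hd2 : holds s2 d by move=> b bt i j; rewrite A2 // hd.
have [A3 T3] := eval_update_entry tf hd2 EN2 Ex2 Ez2.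
split.
- by rewrite eval_frame ?frame_entry.
- by move=> b bt q; rewrite A3 // A2.
- by move=> q qx; rewrite T3 T2 //; case: eqP => // E; move: qx; rewrite E; lia.
- move=> z' lz; rewrite T3; case: eqP => E.
    by have -> : z' = z by apply: val_inj => /=; lia.
  by apply: U2; move: lz E; rewrite ltnS leq_eqVlt => /orP[/eqP/val_inj ->|].
Qed.

Lemma eval_update_all n (d : rels n) phi s :
  tmp_free phi -> holds s d -> var s vN = n ->
  let s' := eval (n * n) (update_all phi) s in
  (forall b, b != tmp -> arr s' b =1 arr s b) /\
  (forall x z : 'I_n, arr s' tmp (x * n + z) = value d phi x z).
Proof.
move=> tf hd EN s'.
pose P k (s' : store) := (forall b, b != tmp -> arr s' b =1 arr s b) /\
  (forall x z : 'I_n, x < k -> arr s' tmp (x * n + z) = value d phi x z).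
suff [] : P n s' by move=> H1 H2; split=> // x z; apply: H2.
apply: eval_For_below; rewrite ?frame_row //.
move=> x s2 Ex2 EN2 [A2 U2].
have hd2 : holds s2 d by move=> b bt i j; rewrite A2 // hd.
have [A3 T3 U3] := eval_update_row tf hd2 EN2 Ex2.
split=> [b bt q|x' z lx]; first by rewrite A3 // A2.
move: lx; rewrite ltnS leq_eqVlt => /orP[/eqP/val_inj ->|lx]; first exact: U3.
(* Earlier rows occupy addresses below [x * n], which filling row [x] leaves alone. *)
by rewrite T3 ?U2 //; have := ltn_ord z; nia.
Qed.

Definition upd n (d : rels n) a (r : 'I_n -> 'I_n -> bool) : rels n :=
  fun b => if b == a then r else d b.

Lemma eval_copy_tmp m a s : a != tmp ->
  let s' := eval m (copy_tmp a) s in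
  forall b q, q < m -> b != tmp ->
    arr s' b q = if b == a then arr s tmp q else arr s b q.
Proof.
move=> at_ s' b q qm bt.
pose P i (s' : store) := (forall q, arr s' tmp q = arr s tmp q) /\
  (forall b q, b != tmp -> arr s' b q = if (b == a) && (q < i) then arr s tmp q else arr s b q).
suff [_ H] : P m s' by rewrite H // qm andbT.
apply: eval_For_ind => //.
  by split=> //= c r ct; rewrite andbF.
move=> i s2 im Ei [T2 A2]; rewrite /P /= Ei im T2 /=.
have E : (tmp == a) = false by apply/negbTE; rewrite eq_sym.
have S c r (bb : bool) : c != tmp -> bb = arr s tmp i ->
    (if (c == a) && (r == i) then bb else arr s2 c r) =
    (if (c == a) && (r < i.+1) then arr s tmp r else arr s c r).
  move=> ct ->; rewrite A2 //; case: (c == a) => //=; rewrite ltnS [r <= i]leq_eqVlt.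
  by case: eqP => // ->.
case: ifP => t /=; rewrite ?Ei; split=> [r|c r ct]; rewrite ?E ?T2 //=; exact: S.
Qed.

Definition state_ok n s (d : rels n) := [/\ holds s d, var s vN = n & var s v0 = 0].

Lemma eval_update n (d : rels n) a phi s : a != tmp -> tmp_free phi -> state_ok s d ->
  state_ok (eval (n * n) (update a phi) s) (upd d a (value d phi)).
Proof.
move=> at_ tf [hd EN E0].
have fr v : v \notin [:: vX, vZ, vY & scratch] -> 
    var (eval (n * n) (update a phi) s) v = var s v.
  rewrite inE negb_or => /andP[vx vs]; apply: eval_frame.
  rewrite -[assigned _]/(vX :: (assigned (update_row phi) ++ [::]) ++ [:: vP]).
  rewrite cats0 in_cons negb_or vx mem_cat negb_or frame_row //.
  by move: vs; rewrite !inE !negb_or => /and4P[].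
have [A2 T2] := eval_update_all tf hd EN.
split; rewrite ?fr // => b bt i j.
rewrite -[eval _ _ s]/(eval (n * n) (copy_tmp a) (eval (n * n) (update_all phi) s)).
rewrite eval_copy_tmp ?index_lt // /upd; case: eqP => _; first exact: T2.
by rewrite A2 // hd.
Qed.

(** [vF] is positive once a true entry of [b] has been met; comparing it with [v0] is the test. *)
Definition first_scan a b : prog :=
  For vP (IfLt v0 vF (Write a vP false)
    (IfBit b vP (Write a vP true ;; Inc _ vF) (Write a vP false))).
Definition first a b : prog := Zero _ vF ;; first_scan a b.

Definition is_first n (r : 'I_n -> 'I_n -> bool) (i j : 'I_n) :=
  r i j && [forall k, forall l, r k l ==> (i * n + j <= k * n + l)].

Lemma eval_first n (d : rels n) a b s : a != b -> a != tmp -> b != tmp -> state_ok s d ->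
  state_ok (eval (n * n) (first a b) s) (upd d a (is_first (d b))).
Proof.
move=> ab at_ bt [hd EN E0]; set m := n * n.
pose none i := ~~ has (arr s b) (iota 0 i).
pose P i (s' : store) := [/\ var s' v0 = 0, (0 < var s' vF) = ~~ none i,
  (forall c, c != a -> arr s' c =1 arr s c) &
  forall q, q < i -> arr s' a q = arr s b q && none q].
have [] : P m (eval m (first a b) s); last first.
  move=> H0 _ Hc Ha; split=> //.
    move=> c ct i j; rewrite /upd; case: eqP => [->|/eqP ca]; last by rewrite Hc // hd.
    rewrite Ha ?index_lt // hd // /is_first; congr andb.
    apply/hasPn/forallP => [H k|H q].
      apply/forallP => l; apply/implyP => dkl; rewrite leqNgt; apply/negP => lt.
      by have := H (k * n + l); rewrite mem_iota /= hd // dkl => /(_ lt).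
    rewrite mem_iota /= add0n => qij; apply/negP => Aq.
    have n0 : 0 < n by have := ltn_ord i; lia.
    (* Division by [n] turns the address [q] back into a pair of indices. *)
    have qd : q %/ n < n by rewrite ltn_divLR //; apply: ltn_trans qij (index_lt i j).
    have qm : q %% n < n by rewrite ltn_mod.
    have Eq : q = Ordinal qd * n + Ordinal qm by rewrite /= -divn_eq.
    have /forallP/(_ (Ordinal qm))/implyP := H (Ordinal qd).
    by rewrite -hd // -Eq => /(_ Aq); rewrite leqNgt qij.
  by rewrite eval_frame.
rewrite -[eval _ _ _]/(eval m (first_scan a b) (setv s vF 0)).
apply: eval_For_ind => //.
move=> i s2 im Ei [H0 HF Hc Ha].
have noneS : none i.+1 = none i && ~~ arr s b i.
  by rewrite /none -[i.+1]addn1 iotaD has_cat /= orbF negb_or.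
have ba : b != a by rewrite eq_sym.
have Hset t c : c != a -> arr (seta s2 a i t) c =1 arr s c.
  by move=> ca q; rewrite /= (negbTE ca) Hc.
have Hseta t : t = arr s b i && none i -> forall q, q < i.+1 ->
    arr (seta s2 a i t) a q = arr s b q && none q.
  move=> -> q; rewrite ltnS leq_eqVlt /= eqxx; case: eqP => [->|_] //=; exact: Ha.
rewrite /P /= H0 HF Ei im Hc // noneS /=.
case Ei': (none i) => /=; last first.
  by rewrite HF Ei'; split=> // [c ca|]; [exact: Hset | apply: Hseta; rewrite Ei' andbF].
case Eb: (arr s b i) => /=.
  rewrite ?Ei /=; split=> //; first by lia.
    by move=> c ca; apply: Hset.
  by apply: Hseta; rewrite Eb Ei'.
rewrite ?Ei ?HF ?Ei'; split=> // [c ca|]; first exact: Hset.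
by apply: Hseta; rewrite Eb.
Qed.

(** * Relational programs *)

Inductive rprog :=
  | RUpd of K & fm
  | RFirst of K & K
  | RSeq of rprog & rprog
  | RIter of name & rprog.

Fixpoint reval n (p : rprog) (d : rels n) : rels n :=
  match p with
  | RUpd a phi => upd d a (value d phi)
  | RFirst a b => upd d a (is_first (d b))
  | RSeq p q => reval q (reval p d)
  | RIter _ p => iter (n * n) (reval p) d
  end.

Fixpoint rcompile (p : rprog) : prog :=
  match p with
  | RUpd a phi => update a phi
  | RFirst a b => first a b
  | RSeq p q => rcompile p ;; rcompile q
  | RIter v p => For v (rcompile p)
  end.

Fixpoint rwf (p : rprog) : bool :=
  match p with
  | RUpd a phi => (a != tmp) && tmp_free phi
  | RFirst a b => [&& a != b, a != tmp & b != tmp]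
  | RSeq p q => rwf p && rwf q
  | RIter v p => (v \notin [:: vN; v0]) && rwf p
  end.

Lemma rcompile_correct n p (d : rels n) s : rwf p -> state_ok s d ->
  state_ok (eval (n * n) (rcompile p) s) (reval p d).
Proof.
elim: p d s => [a phi|a b|p IHp q IHq|v p IH] d s.
- by move=> /andP[at_ tf] ok; apply: eval_update.
- by move=> /and3P[ab at_ bt] ok; apply: eval_first.
- by move=> /andP[wp wq] ok; apply: IHq => //; apply: IHp.
- rewrite /= => /andP[vr wp] ok; have upds t s' d' : state_ok s' d' -> state_ok (setv s' v t) d'.
    move: vr; rewrite !inE negb_or => /andP[/negbTE vn /negbTE v0'].
    by move=> [hd EN E0]; split=> //=; rewrite eq_sym ?vn ?v0'.
  by elim: {1 4}(n * n) => [|k IHk] /=; apply: upds => //; apply: IH.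
Qed.

End Relational.

(** * From relational programs to Turing machines *)

Lemma size_encode_graph n (e : rel 'I_n) : size (encode_graph e) = n * n.
Proof. by rewrite size_allpairs size_enum_ord. Qed.

Lemma nth_encode_graph n (e : rel 'I_n) (i j : 'I_n) :
  nth false (encode_graph e) (i * n + j) = e i j.
Proof.
have H (s : seq 'I_n) k : k < size s ->
    nth false [seq e x y | x <- s, y <- enum 'I_n] (k * n + j) = e (nth i s k) j.
  elim: s k => [|x s IH] [|k] //= ks.
    by rewrite mul0n add0n nth_cat size_map size_enum_ord ltn_ord (nth_map j) ?size_enum_ord ?nth_ord_enum.
  rewrite nth_cat size_map size_enum_ord ifF; last by apply/negbTE; rewrite mulSn; lia.
  by rewrite mulSn -addnA addKn IH.
by rewrite H ?size_enum_ord // nth_ord_enum.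
Qed.

Section Machine.
Variables (K : finType) (tmp aE aS aV : K).
Hypotheses (SV : aS != aV) (St : aS != tmp).
Notation "p ;; q" := (Seq p q).
Notation prog := (prog name K).
Notation store := (store name K).

(* [vN] ends up as the number of [k < m] with [k * k < m], i.e. the square root of [m]. *)
Definition count_order : prog :=
  For vX (Zero _ vP ;; mul_to _ vX vX vP ;; IfLt vP vEnd (Inc _ vN) (Skip _ _)).
Definition set_order : prog := Zero _ vN ;; Zero _ v0 ;; count_order.

(** Marking the first [n] cells makes the printed word stop after [n] bits. *)
Definition mark_output : prog :=
  For vP (IfLt vP vN (Write aV vP true) (Write aV vP false)).

Definition whole (p : rprog K) : prog := set_order ;; rcompile tmp p ;; mark_output.

Definition input_rels n (e : rel 'I_n) : rels K n :=
  fun a => if a == aE then e else fun _ _ => false.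

Lemma eval_set_order n (s : store) : var s vEnd = n * n ->
  let s' := eval (n * n) set_order s in [/\ var s' vN = n, var s' v0 = 0 & arr s' = arr s].
Proof.
move=> Eend s'; split; last exact: arr_write_free.
  set m := n * n in Eend s' *.
  pose P i (s' : store) := var s' vEnd = m /\ var s' vN = minn i n.
  suff [_ ->] : P m s' by rewrite /m; nia.
  rewrite -[s']/(eval m count_order (setv (setv s vN 0) v0 0)).
  apply: eval_For_ind => //.
    by split; rewrite //= min0n.
  move=> i s1 im Ei [E1 N1].
  set s2 := eval m (mul_to _ vX vX vP) (setv s1 vP 0).
  have E2 : var s2 vP = minn m (i * i).
    by rewrite eval_mul_to /= ?Ei //; lia.
  have F2 v : v \notin [:: vP; vI; vJ] -> var s2 v = var s1 v.
    rewrite !inE !negb_or => /and3P[vp vi vj]; rewrite eval_frame /= ?(negbTE vp) //.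
    by rewrite !inE !negb_or vi vj vp.
  rewrite -[eval m _ s1]/(if var s2 vP < var s2 vEnd then incv m vN s2 else s2).
  rewrite E2 (F2 vEnd) // E1; case: ifP => lt; split; rewrite /= ?(F2 vEnd) ?(F2 vN) // N1.
    have : i < n by rewrite /m in lt; nia.
    by rewrite /m; nia.
  have : n <= i by rewrite /m in lt; nia.
  by lia.
rewrite -[s']/(eval (n * n) count_order (setv (setv s vN 0) v0 0)).
by rewrite eval_frame.
Qed.

Lemma eval_mark_output m (s : store) : let s' := eval m mark_output s in
  (forall q, q < m -> arr s' aV q = (q < var s vN)) /\
  (forall b, b != aV -> arr s' b =1 arr s b).
Proof.
move=> s'.
pose P i (s' : store) := [/\ var s' vN = var s vN,
  (forall q, q < i -> arr s' aV q = (q < var s vN)) &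
  (forall b, b != aV -> arr s' b =1 arr s b)].
suff [] : P m s' by [].
apply: eval_For_ind => //.
move=> i s1 im Ei [N1 A1 B1].
have W b : b = (i < var s vN) -> P i.+1 (incv m vP (seta s1 aV i b)).
  move=> ->; split=> // [q|c ca q] /=; last by rewrite (negbTE ca) B1.
  by rewrite eqxx ltnS leq_eqVlt; case: eqP => [->|_] //=; apply: A1.
by rewrite /= N1 Ei; case: ifP => lt; apply: W.
Qed.

Definition read_input (b : bool) : cell name K :=
  ([ffun => false], [ffun a => (a == aE) && b]).
Definition print_cell (c : cell name K) : option bool :=
  if c.2 aV then Some (c.2 aS) else None.

Lemma printed_marked (w : seq (cell name K)) c0 n : n <= size w ->
  (forall q, q < size w -> (nth c0 w q).2 aV = (q < n)) ->
  printed print_cell w = [seq (nth c0 w j).2 aS | j <- iota 0 n].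
Proof.
elim: w n => [|c w IH] [|n] //= nw H; rewrite /print_cell (H 0) //.
rewrite -/print_cell (IH n) //=; last by move=> q qw; apply: (H q.+1).
by rewrite (iotaDl 1 0) -map_comp.
Qed.

(** One constant must serve as factor, exponent and summand. For positive [m], [m + 2 <= 3 * m] and
    [c <= 3 ^ c]; the summand handles [m = 0]. *)
Lemma poly_bound c m : (m + 2) ^ c <= 3 ^ c * m ^ (3 ^ c) + 3 ^ c.
Proof.
case: m => [|m].
  by rewrite add0n; apply: (leq_trans _ (leq_addl _ _)); case: c => // c; rewrite leq_exp2r.
apply: (leq_trans _ (leq_addr _ _)).
apply: (@leq_trans ((3 * m.+1) ^ c)).
  by case: c => // c; rewrite leq_exp2r //; lia.
rewrite expnMn leq_mul // leq_pexp2l //.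
by apply: ltnW; apply: ltn_expl.
Qed.

(** Row [0] of [aS] occupies the first [n] cells, so the printed bits are that row. *)
Theorem relational_tm (p : rprog K) : rwf tmp p -> wf (whole p) ->
  exists (M : TM) (d : nat), forall n (e : rel 'I_n),
  exists k (c : config M),
    [/\ k <= d * (size (encode_graph e)) ^ d + d,
      exec M k (init M (encode_graph e)) = Some c, step M c = None,
      size (output M c) = n &
      forall i j : 'I_n, i = 0 :> nat ->
        nth false (output M c) j = reval p (input_rels e) aS i j].
Proof.
move=> rwfp wfp.
have [c Hc] := cost_poly (whole p).
(* The time is at most [(m + 2) ^ c * 2] passes of [(m + 2) * 2] moves, and
   [4 * (m + 2) <= (m + 2) ^ 3]. *)
exists (sweep_tm (compile (whole p)) read_input print_cell), (3 ^ (c + 3)) => n e.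
set m := n * n; set w := encode_graph e.
have szw : size w = m by exact: size_encode_graph.
(* A fresh tape carries no tokens, so every variable starts at [m]; [set_order] reads the tape
   length from [vEnd]. *)
pose s0 : store := Store (fun _ => m) (fun a q => (a == aE) && nth false w q).
have r0 : represents m (map read_input w) s0.
  move=> c0; split; rewrite ?size_map //.
    move=> q v qm; rewrite (nth_map false) ?szw //= ffunE.
    by apply/esym/negbTE; rewrite neq_ltn qm.
  by move=> q a qm; rewrite (nth_map false) ?szw //= ffunE.
have [k [w' [kc ex r']]] := compile_correct wfp r0.
have [t [cf [tb He Hs Ho]]] := sweep_tm_correct print_cell ex.
have [N1 Z1 A1] := eval_set_order (erefl : var s0 vEnd = n * n).
set s1 := eval _ set_order s0 in N1 Z1 A1.
have ok1 : state_ok tmp s1 (input_rels e).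
  split=> // b bt i j; rewrite A1 /= /input_rels; case: eqP => //= _.
  exact: nth_encode_graph.
have [h2 N2 _] := rcompile_correct rwfp ok1.
set s2 := eval _ _ s1 in h2 N2.
have [aVE aB] := eval_mark_output m s2.
have nn : n <= m by rewrite /m; nia.
pose c0 := read_input false.
have [sz' _ _ ea] := r' c0.
have out_eq : printed print_cell w' = [seq (nth c0 w' j).2 aS | j <- iota 0 n].
  apply: printed_marked; rewrite sz' // => q qm.
  by rewrite ea // -N2; apply: aVE.
exists t, cf; split=> //.
- apply: (leq_trans tb); rewrite szw; apply: (leq_trans _ (poly_bound _ _)).
  have y0 : 0 < (m + 2) ^ c by rewrite expn_gt0 addn2.
  have ky : k.+1 <= (m + 2) ^ c * 2 by have := leq_trans kc (Hc m); lia.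
  apply: (leq_trans (leq_mul ky (_ : m.+1.*2 <= (m + 2) * 2))); first by lia.
  rewrite expnD -mulnA leq_mul2l; apply/orP; right.
  by rewrite !expnS expn0; nia.
- by rewrite Ho out_eq size_map size_iota.
- move=> i j i0; rewrite Ho out_eq (nth_map 0) ?size_iota // nth_iota // add0n.
  have jm : j < m by apply: leq_trans (ltn_ord j) nn.
  rewrite ea // aB // -(h2 _ St) i0 mul0n add0n.
  done.
Qed.

End Machine.

(** * Bipartite matching by rotations *)

(** Every proper step lowers [mu], so at most [mu x] of them occur before a fixpoint, and further
    iterations change nothing. *)
Lemma iter_fixpoint (X : Type) (P : X -> Prop) (f : X -> X) (mu : X -> nat) :
  (forall x, P x -> f x = x \/ P (f x) /\ mu (f x) < mu x) ->
  forall k x, P x -> mu x <= k -> P (iter k f x) /\ f (iter k f x) = iter k f x.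
Proof.
move=> H; elim=> [|k IH] x Px mx.
  by split=> //=; have [//|[_]] := H x Px; move: mx; lia.
rewrite iterSr; have [E|[Pf lt]] := H x Px; last by apply: IH => //; lia.
suff -> : iter k f (f x) = x by rewrite E.
by elim: k {IH mx} => [|k IH] //=; rewrite ?IH.
Qed.

Lemma iter_inflationary (T : finType) (f : {set T} -> {set T}) :
  (forall S : {set T}, S \subset f S) ->
  forall k S, #|T| <= k -> f (iter k f S) = iter k f S.
Proof.
move=> H k S Tk; have := @iter_fixpoint _ (fun _ => True) f (fun S => #|T| - #|S|).
move=> /(_ _ k S I) []; last by move=> _ ->.
  move=> U _; case: (eqVneq (f U) U) => [|ne]; [by left | right; split=> //].
  have : #|U| < #|f U| by rewrite proper_card // properEneq eq_sym ne H.
  by have : #|f U| <= #|T| := max_card _; lia.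
by lia.
Qed.

(** Set form of [is_first]: distinct pairs have distinct addresses, so at most one pair is left. *)
Definition firsts n (C : {set 'I_n * 'I_n}) : {set 'I_n * 'I_n} :=
  [set p in C | [forall q in C, p.1 * n + p.2 <= q.1 * n + q.2]].

Lemma firsts0 n : firsts (set0 : {set 'I_n * 'I_n}) = set0.
Proof. by apply/setP => p; rewrite !inE. Qed.

Lemma firstsP n (C : {set 'I_n * 'I_n}) : C != set0 ->
  exists2 p, p \in C & firsts C = [set p].
Proof.
case/set0Pn => p0 p0C.
case: (arg_minnP (fun p : 'I_n * 'I_n => p.1 * n + p.2) p0C) => p pC min.
exists p => //; apply/setP => q; rewrite !inE; apply/andP/eqP => [[qC /forall_inP H]|->].
  have E : q.1 * n + q.2 = p.1 * n + p.2.
    by apply/eqP; rewrite eqn_leq H //= min.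
  have := ltn_ord q.1; have := ltn_ord q.2; have := ltn_ord p.1; have := ltn_ord p.2.
  case: q p {qC H min pC} E => q1 q2 [p1 p2] /= E *.
  have E1 : q1 = p1 :> nat by nia.
  congr pair; apply: val_inj => //=; nia.
by split=> //; apply/forall_inP => q' q'C; apply: min.
Qed.

Section Matching.
Variables (n : nat) (e : rel 'I_n) (A : {set 'I_n}) (m : nat).
Hypotheses (e_sym : symmetric e) (e_irr : irreflexive e).
Hypothesis (e_bip : forall x y, e x y -> (x \in A) != (y \in A)).
Hypothesis (nm : n <= m).
Implicit Types (M P : {set 'I_n * 'I_n}) (S : {set 'I_n}).

(** Each matching edge is stored in both directions, which makes [M] the graph of a partial
    involution. *)
Definition matching M := [/\ forall x y, (x, y) \in M -> (y, x) \in M,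
  forall x y, (x, y) \in M -> e x y &
  forall x y z, (x, y) \in M -> (x, z) \in M -> y = z].

Definition exposed M := [set x | ~~ [exists y, (x, y) \in M]].
Definition next_to S := [set y | [exists w, e y w && (w \in S)]].
Definition spread M S := S :|: [set z | [exists y, ((z, y) \in M) && (y \in next_to S)]].
Definition level M k := iter k (spread M) (exposed M).
Definition augmentable M S := [exists u, (u \in exposed M) && (u \in next_to S)].
(** Growth freezes at the first augmentable level, so [search] returns the lowest level adjacent to
    an exposed vertex, if there is one. *)
Definition grow M S := if augmentable M S then S else spread M S.
Definition search M := iter m (grow M) (exposed M).
Definition candidates M := [set p | [&& p.1 \in exposed M, e p.1 p.2 & p.2 \in search M]].
Definition hit P := [set w | [exists y, (y, w) \in P]].
(** For [P] consisting of one pair [(u, w)], the matching edge at [w] is dropped and [uw] is added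
    in both directions. *)
Definition rotate M P := [set p | [|| [&& p \in M, p.1 \notin hit P & p.2 \notin hit P],
  p \in P | (p.2, p.1) \in P]].
Definition augment M := rotate M (firsts (candidates M)).

Lemma exposedPn M x : reflect (exists y, (x, y) \in M) (x \notin exposed M).
Proof. by rewrite inE negbK; apply: existsP. Qed.

Lemma exposedP M x y : x \in exposed M -> (x, y) \in M -> False.
Proof. by rewrite inE => /existsPn/(_ y)/negP. Qed.

Lemma next_toP S y : reflect (exists2 w, e y w & w \in S) (y \in next_to S).
Proof.
by rewrite inE; apply: (iffP existsP) => [[w /andP[]]|[w H1 H2]]; exists w => //; apply/andP.
Qed.

Lemma spreadP M S z :
  reflect (z \in S \/ exists y w, [/\ (z, y) \in M, e y w & w \in S]) (z \in spread M S).
Proof.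
rewrite !inE; apply: (iffP orP) => [[|/existsP[y /andP[H1 /next_toP[w H2 H3]]]]|[|[y [w [H1 H2 H3]]]]].
- by left.
- by right; exists y, w.
- by left.
- by right; apply/existsP; exists y; rewrite H1; apply/next_toP; exists w.
Qed.

Lemma sub_spread M S : S \subset spread M S.
Proof. exact: subsetUl. Qed.

Lemma augmentableP M S :
  reflect (exists u w, [/\ u \in exposed M, e u w & w \in S]) (augmentable M S).
Proof.
apply: (iffP existsP) => [[u /andP[H1 /next_toP[w H2 H3]]]|[u [w [H1 H2 H3]]]].
  by exists u, w.
by exists u; rewrite H1; apply/next_toP; exists w.
Qed.

Lemma searchP M : exists i, [/\ i <= m, search M = level M i,
  forall j, j < i -> ~~ augmentable M (level M j) &
  i < m -> augmentable M (level M i)].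
Proof.
rewrite /search; elim: m => [|k [i [ik E H1 H2]]]; first by exists 0.
rewrite iterS E /grow; case: ifP => [Ha|/negbT Hn].
  by exists i; split=> //; apply: ltnW.
have Ei : i = k by apply/eqP; rewrite eqn_leq ik leqNgt; apply/negP => /H2; apply/negP.
exists i.+1; split=> //; last by rewrite Ei ltnn.
by move=> j; rewrite ltnS leq_eqVlt => /orP[/eqP ->|/H1].
Qed.

(** The default of [find] gives [m.+1] when no level up to [m] is augmentable. *)
Definition rank M := find (fun j => augmentable M (level M j)) (iota 0 m.+1).

Lemma rank_le M i : i <= m -> augmentable M (level M i) -> rank M <= i.
Proof.
move=> im aug; rewrite leqNgt; apply/negP => lt.
by have := before_find 0 lt; rewrite nth_iota // add0n aug.
Qed.

Lemma rank_max M : rank M <= m.+1.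
Proof. by rewrite -[X in _ <= X](size_iota 0 m.+1) find_size. Qed.

Lemma rank_eq M i : i <= m -> augmentable M (level M i) ->
  (forall j, j < i -> ~~ augmentable M (level M j)) -> rank M = i.
Proof.
move=> im aug H; apply/eqP; rewrite eqn_leq rank_le //= leqNgt; apply/negP => lt.
have hs : has (fun j => augmentable M (level M j)) (iota 0 m.+1).
  by apply/hasP; exists i => //; rewrite mem_iota.
have := nth_find 0 hs; rewrite -/(rank M) nth_iota; last by lia.
by rewrite add0n => aug2; have := H _ lt; rewrite aug2.
Qed.

(** * The effect of one rotation *)

Section Rotate.
Variables (M : {set 'I_n * 'I_n}) (u w : 'I_n).
Hypotheses (matM : matching M) (uX : u \in exposed M) (euw : e u w).
Let M' := rotate M [set (u, w)].

Lemma rotateE x y : ((x, y) \in M') =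
  [|| [&& (x, y) \in M, x != w & y != w], (x == u) && (y == w) | (x == w) && (y == u)].
Proof.
have hitE z : (z \in hit [set (u, w)]) = (z == w).
  rewrite inE; apply/existsP/eqP => [[y']|->]; first by rewrite inE => /eqP[_ ->].
  by exists u; rewrite inE.
rewrite in_set /= !hitE !inE !xpair_eqE.
by rewrite [(y == u) && _]andbC.
Qed.

Lemma uw_neq : u != w.
Proof. by apply/negP => /eqP E; move: euw; rewrite E e_irr. Qed.

Lemma matching_rotate : matching M'.
Proof.
have [sy sub fn] := matM; have uw := uw_neq.
split=> [x y|x y|x y z].
- rewrite !rotateE => /or3P[/and3P[H -> ->]|/andP[-> ->]|/andP[-> ->]]; rewrite ?orbT //.
  by rewrite sy.
- rewrite rotateE => /or3P[/and3P[H _ _]|/andP[/eqP-> /eqP->]|/andP[/eqP-> /eqP->]] //.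
    exact: sub.
  by rewrite e_sym.
- rewrite !rotateE => /or3P[/and3P[H xw yw]|/andP[/eqP Ex /eqP->]|/andP[/eqP Ex /eqP->]]
    /or3P[/and3P[H' xw' zw]|/andP[/eqP Ex' /eqP->]|/andP[/eqP Ex' /eqP->]] //.
  + exact: fn H H'.
  + by subst x; have := exposedP uX H.
  + by rewrite Ex' eqxx in xw.
  + by subst x; have := exposedP uX H'.
  + by subst x; rewrite Ex' eqxx in uw.
  + by rewrite Ex eqxx in xw'.
  + by subst x; rewrite Ex' eqxx in uw.
Qed.

Lemma exposed_rotate x : x \in exposed M' ->
  [/\ x != u, x != w & x \in exposed M \/ (x, w) \in M].
Proof.
move=> xX; split.
- by apply/negP => /eqP E; apply: (exposedP xX (y := w)); rewrite rotateE E !eqxx orbT.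
- by apply/negP => /eqP E; apply: (exposedP xX (y := u)); rewrite rotateE E !eqxx !orbT.
case: (boolP (x \in exposed M)); first by left.
move=> /exposedPn[y xy]; right; case: (eqVneq y w) => [<- //|yw].
case: (eqVneq x w) => [E|xw].
  by exfalso; apply: (exposedP xX (y := u)); rewrite rotateE E !eqxx !orbT.
by exfalso; apply: (exposedP xX (y := y)); rewrite rotateE xy xw yw.
Qed.

Lemma card_exposed_rotate0 : w \in exposed M -> #|exposed M'| < #|exposed M|.
Proof.
move=> wX; apply: proper_card; apply/properP; split.
  apply/subsetP => x /exposed_rotate[_ _ [//|xw]].
  by have [sy _ _] := matM; case: (exposedP wX (sy _ _ xw)).
by exists u => //; apply/negP => /exposed_rotate[/eqP].
Qed.

(** [u] becomes matched, and only the old mate of [w] can become exposed. *)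
Lemma card_exposed_rotate : #|exposed M'| <= #|exposed M|.
Proof.
case: (boolP (w \in exposed M)) => [/card_exposed_rotate0/ltnW //|/exposedPn[y wy]].
have [sy _ fn] := matM.
apply: (@leq_trans #|y |: exposed M :\ u|).
  apply: subset_leq_card; apply/subsetP => x /exposed_rotate[xu _ [xX|xw]].
    by rewrite !inE xu; rewrite inE in xX; rewrite xX orbT.
  by rewrite !inE (fn _ _ _ (sy _ _ xw) wy) eqxx.
by rewrite (leq_trans (leq_card_setU _ _)) // cards1 [#|exposed M|](cardsD1 u) uX.
Qed.

(* Only [u], [w] and the old mate of [w] change partners, so the levels below the
   one where [w] appears survive on the side of [w]. *)
Lemma level_rotate i : w \notin level M i -> forall j, j <= i ->
  forall z, z \in level M j -> (z \in A) = (w \in A) -> z \in level M' j.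
Proof.
have [sy sub fn] := matM => wi.
have mono j k : j <= k -> level M j \subset level M k.
  elim: k => [|k IH]; first by case: j.
  rewrite leq_eqVlt => /orP[/eqP->//|/IH H]; exact: subset_trans H (sub_spread _ _).
have uA : (u \in A) != (w \in A) by exact: e_bip.
elim=> [|j IH] ji z.
  move=> zX zA /=; rewrite inE; apply/existsPn => y; rewrite rotateE.
  apply/negP => /or3P[/and3P[H _ _]|/andP[/eqP E _]|/andP[/eqP E _]].
  - exact: exposedP zX H.
  - by move: uA; rewrite -E zA eqxx.
  - by move/negP: wi; apply; apply: (subsetP (mono 0 i _)) => //; rewrite -E.
move=> /= /spreadP[zj|[y [w' [zy yw' w'j]]]] zA; apply/spreadP.
  by left; apply: IH => //; apply: ltnW.
right; exists y, w'; split=> //; last first.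
  apply: IH => //; first exact: ltnW.
  by have := e_bip yw'; have := e_bip (sub _ _ zy); rewrite -zA; do 3 case: (_ \in A).
(* The pair [zy] survives: [z = w] would put [w] into level [j.+1], hence into level [i], and [y]
   lies on the side opposite to [w]. *)
rewrite rotateE zy /=; apply/orP; left; apply/andP; split.
  apply/negP => /eqP E; move/negP: wi; apply; rewrite -E.
  apply: (subsetP (mono j.+1 i ji)); apply/spreadP; right; by exists y, w'.
by apply/negP => /eqP E; have := e_bip (sub _ _ zy); rewrite zA E eqxx.
Qed.

End Rotate.

(** A lexicographic measure: [rank] is at most [m.+1], so one exposed vertex fewer outweighs any
    change of rank. *)
Definition potential M := #|exposed M| * m.+2 + rank M.

Lemma candidatesP M p : reflect
  [/\ p.1 \in exposed M, e p.1 p.2 & p.2 \in search M] (p \in candidates M).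
Proof. by rewrite [p \in candidates M]in_set; apply: and3P. Qed.

Lemma candidates0 M : candidates M = set0 ->
  augment M = M /\ search M = level M m /\ ~~ augmentable M (level M m).
Proof.
move=> C0; have na : ~~ augmentable M (search M).
  apply/negP => /augmentableP[u [w [H1 H2 H3]]].
  have : (u, w) \in candidates M by apply/candidatesP.
  by rewrite C0 inE.
split.
  rewrite /augment C0 firsts0; apply/setP => p; rewrite !inE !orbF.
  have h0 x : [exists y, (y, x) \in (set0 : {set 'I_n * 'I_n})] = false.
    by apply/negbTE/existsPn => y; rewrite inE.
  by rewrite !h0 !andbT.
have [i [im Es H1 H2]] := searchP M.
have Ei : i = m.
  by apply/eqP; rewrite eqn_leq im leqNgt; apply/negP => /H2; rewrite -Es; apply/negP.
by rewrite -Ei -Es.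
Qed.

(** If [w] is exposed, an edge is gained. Otherwise the freed mate [y] of [w] is adjacent to a
    vertex [w'] of the level below, which survives the rotation, so the number of exposed vertices
    does not grow and the rank drops. *)
Lemma augment_progress M : matching M ->
  candidates M = set0 \/ matching (augment M) /\ potential (augment M) < potential M.
Proof.
move=> matM; case: (eqVneq (candidates M) set0) => [|/firstsP[[u w]]]; first by left.
move=> /candidatesP[/= uX euw wS]; rewrite /augment => ->; right.
split; first exact: matching_rotate.
have [i [im Es H1 _]] := searchP M; rewrite Es in wS.
have aug : augmentable M (level M i) by apply/augmentableP; exists u, w.
rewrite /potential (rank_eq im aug H1).
set M' := rotate _ _.
case: i im wS {Es aug} H1 => [|i] im wS H1.
  have := card_exposed_rotate0 matM uX wS; have := rank_max M'.
  rewrite -/M'; nia.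
have [sy sub fn] := matM.
have wi : w \notin level M i.
  by apply/negP => wi; have := H1 i (ltnSn i); move/negP; apply; apply/augmentableP; exists u, w.
have := card_exposed_rotate w matM uX; rewrite -/M' => cd.
suff : rank M' <= i by nia.
apply: rank_le; first by lia.
case/spreadP: wS => [/(negP wi) //|[y [w' [wy yw' w'i]]]].
apply/augmentableP; exists y, w'; split=> //.
  have yw : y != w.
    by apply/negP => /eqP E; have := e_bip (sub _ _ wy); rewrite E eqxx.
  have yu : y != u.
    by apply/negP => /eqP E; subst y; apply: (exposedP uX (sy _ _ wy)).
  rewrite inE; apply/existsPn => z; rewrite rotateE (negbTE yu) (negbTE yw) /= orbF.
  by apply/negP => /andP[yz zw]; rewrite (fn _ _ _ yz (sy _ _ wy)) eqxx in zw.
apply: (level_rotate matM euw wi (leqnn i)) => //.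
by have := e_bip yw'; have := e_bip (sub _ _ wy); do 3 case: (_ \in A).
Qed.

Lemma matching0 : matching set0.
Proof. by split=> [x y|x y|x y z]; rewrite inE. Qed.

(** The bound on [k] is the largest possible potential. With at most one vertex there is no edge,
    and the empty matching is already final. *)
Lemma iter_augment k : (1 < n -> n * m.+2 + m.+1 <= k) ->
  let M := iter k augment set0 in
  [/\ matching M, search M = level M m & ~~ augmentable M (level M m)].
Proof.
move=> hk M; suff [matM C0] : matching M /\ candidates M = set0.
  by have [_ []] := candidates0 C0.
case: (ltnP 1 n) => [n1|n1].
  have prog M1 : matching M1 ->
      augment M1 = M1 \/ matching (augment M1) /\ potential (augment M1) < potential M1.
    by move=> /augment_progress[/candidates0[]|]; [left | right].
  have [|matM fixM] := iter_fixpoint prog (k := k) matching0.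
    apply: leq_trans (hk n1); rewrite /potential leq_add ?rank_max // leq_mul2r.
    by rewrite -[X in _ <= X](card_ord n) max_card.
  split=> //; have [//|[_]] := augment_progress matM.
  by rewrite fixM ltnn.
have C0 M1 : candidates M1 = set0.
  apply/setP => -[x y]; rewrite !inE /=.
  have -> : x = y by apply: val_inj => /=; have := ltn_ord x; have := ltn_ord y; lia.
  by rewrite e_irr andbF.
split=> //; suff -> : M = set0 by exact: matching0.
rewrite /M; elim: k {hk M} => [|k IH] //=; rewrite IH.
by have [] := candidates0 (C0 set0).
Qed.

Lemma level_closed M : spread M (level M m) = level M m.
Proof. by apply: iter_inflationary; rewrite ?card_ord // => S; apply: sub_spread. Qed.

End Matching.

(** * Choosing a maximum stable set *)

Section Selection.
Variables (n : nat) (e : rel 'I_n) (A : {set 'I_n}) (m : nat).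
Hypotheses (e_sym : symmetric e) (e_irr : irreflexive e).
Hypothesis (e_bip : forall x y, e x y -> (x \in A) != (y \in A)).
Hypothesis (nm : n <= m).
Variable M : {set 'I_n * 'I_n}.
Hypothesis matM : matching e M.
Implicit Types S T : {set 'I_n}.

Definition partnered S := [set z | [exists y, ((z, y) \in M) && (y \in S)]].
(** Vertices of degree at least two; the others play the part of leaves, isolated vertices
    included. *)
Definition forked := [set z | [exists y, e z y && [exists y', e z y' && (y' != y)]]].
Definition free S := [set z | (z \notin S) && (z \notin partnered S)].
Definition picks S := [set z | (z \in free S) &&
  (~~ [exists y, (y \in free S) && (y \notin forked)] || (z \notin forked))].
(** Diagonal pairs are used because [firsts] selects among pairs. *)
Definition picked S := [set z | (z, z) \in firsts [set p | (p.1 == p.2) && (p.2 \in picks S)]].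
Definition close S := iter m (spread e M) S.
Definition enlarge S := close (S :|: picked S).

(** The invariant of the selection: with no free vertex left and no augmentation possible, it makes
    [S] a maximum stable set. *)
Definition admits S := [/\ spread e M S = S, exposed M \subset S &
  forall x y, (x, y) \in M -> x \in S -> y \notin S].

Lemma forkedPn z y y' : z \notin forked -> e z y -> e z y' -> y = y'.
Proof.
rewrite inE => /existsPn/(_ y) + zy zy'; rewrite zy => /existsPn/(_ y').
by rewrite zy' negbK => /eqP.
Qed.

Lemma partneredP S z : reflect (exists2 y, (z, y) \in M & y \in S) (z \in partnered S).
Proof.
by rewrite inE; apply: (iffP existsP) => [[w /andP[]]|[w H1 H2]]; exists w => //; apply/andP.
Qed.

Lemma spread_mate S x y z : spread e M S = S -> x \in S -> e x y -> (y, z) \in M -> z \in S.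
Proof.
have [sy _ _] := matM; move=> cl xS xy yz; rewrite -cl; apply/spreadP; right.
by exists y, x; split=> //; [exact: sy | rewrite e_sym].
Qed.

Lemma sub_close S : S \subset close S.
Proof.
rewrite /close; elim: m => [|k IH] //=.
exact: subset_trans IH (sub_spread _ _ _).
Qed.

Lemma spread_close S : spread e M (close S) = close S.
Proof. by apply: iter_inflationary; rewrite ?card_ord // => T; apply: sub_spread. Qed.

Lemma close_sub S T : S \subset T -> spread e M T \subset T -> close S \subset T.
Proof.
move=> ST cT; rewrite /close; elim: m => [|k IH] //=; apply: subset_trans cT.
apply/subsetP => z /spreadP[zS|[y [w [H1 H2 H3]]]]; apply/spreadP.
  by left; apply: (subsetP IH).
by right; exists y, w; split=> //; apply: (subsetP IH).
Qed.

Lemma exposed_sub_level k : exposed M \subset level e M k.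
Proof.
elim: k => [|k IH] //=; exact: subset_trans IH (sub_spread _ _ _).
Qed.

(** A conflict at [z] is traced back to the vertex [w] from which [z] was reached: either [w] is
    exposed, and then the last level is augmentable, or [w] is in conflict with its own mate one
    level lower. *)
Lemma admits_level : ~~ augmentable e M (level e M m) -> admits (level e M m).
Proof.
move=> na; have [sy sub fn] := matM; set L := level e M m in na *.
have cl : spread e M L = L by exact: level_closed.
split=> //; first exact: exposed_sub_level.
have H k z : z \in level e M k -> z \notin partnered L.
  elim: k z => [|k IH] z /=.
    by move=> zX; apply/negP => /partneredP[y zy _]; apply: exposedP zX zy.
  case/spreadP => [/IH //|[y [w [zy yw wk]]]].
  apply/negP => /partneredP[y' zy']; rewrite (fn _ _ _ zy' zy) => yL.
  have [wX|/exposedPn[w' ww']] := boolP (w \in exposed M).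
    by move/negP: na; apply; apply/augmentableP; exists w, y; rewrite e_sym.
  have w'L : w' \in L by apply: spread_mate ww'; eauto.
  by move/negP: (IH _ wk); apply; apply/partneredP; exists w'.
move=> x y xy /H xL; apply/negP => yL; move/negP: xL; apply; apply/partneredP.
by exists y.
Qed.

Lemma admits_close S x : admits S -> x \in free S -> admits (close (x |: S)).
Proof.
move=> [cl XS cons]; rewrite in_set => /andP[xS /negP xP]; have [sy sub fn] := matM.
(* [Q] is closed and contains [x], so it bounds the closure. It has no conflict: vertices outside
   [S] lie on the side of [x] and have their mates outside [S]. *)
pose Q := S :|: [set z | ((z \in A) == (x \in A)) && [exists y, ((z, y) \in M) && (y \notin S)]].
have mateQ z y : z \in Q -> z \notin S -> (z, y) \in M -> y \notin S.
  move=> zQ zS zy; move: zQ; rewrite in_setU (negbTE zS) in_set /=.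
  by move=> /andP[_ /existsP[y' /andP[zy' y'S]]]; rewrite (fn _ _ _ zy zy').
have sideQ z : z \in Q -> z \notin S -> (z \in A) = (x \in A).
  by move=> zQ zS; move: zQ; rewrite in_setU (negbTE zS) in_set /= => /andP[/eqP].
have clQ : spread e M Q \subset Q.
  apply/subsetP => z /spreadP[//|[y [w [zy yw wQ]]]].
  have [wS|wS] := boolP (w \in S).
    rewrite inE; apply/orP; left; apply: (spread_mate cl wS _ (sy _ _ zy)).
    by rewrite e_sym.
  have [zS|zS] := boolP (z \in S); first by rewrite inE zS.
  rewrite !inE (negbTE zS) /=; apply/andP; split.
    have := e_bip yw; have := e_bip (sub _ _ zy); rewrite -(sideQ w) //.
    by do 3 case: (_ \in A).
  apply/existsP; exists y; rewrite zy /=; apply/negP => yS.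
  (* If [y] were in [S], closedness would put the mate of [w] into [S]. *)
  have wX : w \notin exposed M by apply/negP => /(subsetP XS); apply/negP.
  have [w' ww'] := exposedPn _ _ wX.
  by move/negP: (mateQ _ _ wQ wS ww'); apply; apply: spread_mate ww'; eauto.
have subQ : close (x |: S) \subset Q.
  apply: close_sub => //; apply/subsetP => z; rewrite in_setU1 => /orP[/eqP ->|zS]; last first.
    by rewrite inE zS.
  have xX : x \notin exposed M by apply/negP => /(subsetP XS); apply/negP.
  have [x' xx'] := exposedPn _ _ xX.
  rewrite !inE eqxx /=; apply/orP; right; apply/existsP; exists x'; rewrite xx' /=.
  by apply/negP => x'S; apply/xP/partneredP; exists x'.
split; first exact: spread_close.
  by apply: subset_trans XS (subset_trans _ (sub_close _)); apply: subsetUr.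
move=> a b ab /(subsetP subQ) aQ; apply/negP => /(subsetP subQ) bQ.
have [aS|aS] := boolP (a \in S).
  have bS := cons _ _ ab aS.
  by move/negP: (mateQ _ _ bQ bS (sy _ _ ab)); apply.
have bS := mateQ _ _ aQ aS ab.
by have := e_bip (sub _ _ ab); rewrite (sideQ a) // (sideQ b) // eqxx.
Qed.

Lemma picked0 S : free S = set0 -> picked S = set0.
Proof.
move=> f0; rewrite /picked; have -> : [set p | (p.1 == p.2) && (p.2 \in picks S)] = set0.
  by apply/setP => p; rewrite in_set [_ \in picks S]in_set f0 !inE andbF.
by rewrite firsts0; apply/setP => z; rewrite !inE.
Qed.

Lemma pickedP S : free S != set0 -> exists2 x, x \in picks S & picked S = [set x].
Proof.
move=> /set0Pn[x0 x0f].
have [x xp] : exists x, x \in picks S.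
  have [/existsP[y /andP[yf yl]]|no] := boolP [exists y, (y \in free S) && (y \notin forked)].
    by exists y; rewrite in_set yf yl orbT.
  by exists x0; rewrite in_set x0f no.
have : [set p | (p.1 == p.2) && (p.2 \in picks S)] != set0.
  by apply/set0Pn; exists (x, x); rewrite in_set eqxx.
case/firstsP => -[y z]; rewrite in_set /= => /andP[/eqP <- yp] E.
exists y => //; apply/setP => z'; rewrite in_set E !inE xpair_eqE.
by rewrite andbb.
Qed.

Lemma picks_free S x : x \in picks S -> x \in free S.
Proof. by rewrite in_set => /andP[]. Qed.

Lemma admits_enlarge S : admits S ->
  (free S = set0 /\ enlarge S = S) \/
  exists2 x, x \in picks S & enlarge S = close (x |: S) /\ admits (enlarge S).
Proof.
move=> adm; have [f0|fn0] := eqVneq (free S) set0.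
  left; split=> //; rewrite /enlarge picked0 // setU0.
  have [cl _ _] := adm; rewrite /close; elim: m => [|k IH] //=.
  by rewrite IH.
right; have [x xp E] := pickedP fn0; exists x => //.
rewrite /enlarge E setUC; split=> //; apply: admits_close => //; exact: picks_free.
Qed.

(** Every proper step adds a vertex, so [n] rounds exhaust the free vertices. *)
Lemma iter_enlarge k S : n <= k -> admits S ->
  admits (iter k enlarge S) /\ free (iter k enlarge S) = set0.
Proof.
move=> nk adm.
have step T : admits T -> enlarge T = T \/ admits (enlarge T) /\ #|~: enlarge T| < #|~: T|.
  move=> /admits_enlarge[[_]|[x xp [E adm']]]; first by left.
  right; split=> //; apply: proper_card; rewrite properC E; apply/properP; split.
    by apply: subset_trans (sub_close _); apply: subsetUr.
  exists x; first by apply: (subsetP (sub_close _)); rewrite setU11.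
  by have := picks_free xp; rewrite inE => /andP[].
have [|admk fixk] := iter_fixpoint step (k := k) adm.
  by apply: leq_trans nk; rewrite -[X in _ <= X](card_ord n) max_card.
split=> //; have [[]//|[x xp [E _]]] := admits_enlarge admk.
have : x \in iter k enlarge S.
  by rewrite -fixk E; apply: (subsetP (sub_close _)); rewrite setU11.
by have := picks_free xp; rewrite inE => /andP[/negbTE ->].
Qed.

(** The mate of a free vertex is free, so a free vertex comes with a free leaf and [picks] offers
    only leaves; closing adds no forked vertex. *)
Lemma iter_enlarge_leaves k S : exposed M = set0 ->
  (forall x y, (x, y) \in M -> x \notin forked \/ y \notin forked) ->
  admits S -> [disjoint S & forked] -> [disjoint iter k enlarge S & forked].
Proof.
move=> X0 pair adm dis; have [sy sub fn] := matM.
suff : admits (iter k enlarge S) /\ [disjoint iter k enlarge S & forked] by case.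
elim: k => [|k [admk disk]] //=; set T := iter k enlarge S in admk disk *.
have [[_ ->] //|[x xp [E adm']]] := admits_enlarge admk.
split=> //; rewrite E.
have xf : x \notin forked.
  move: xp; rewrite in_set => /andP[xfree /orP[/existsPn no|//]].
  have xX : x \notin exposed M by rewrite X0 inE.
  have [y xy] := exposedPn _ _ xX.
  have [//|yf] := pair _ _ xy; have := no y; rewrite yf andbT in_set.
  move: xfree; rewrite in_set => /andP[xT /negP xT'].
  rewrite negb_and !negbK => /orP[yT|/partneredP[x' yx']].
    by case: xT'; apply/partneredP; exists y.
  by rewrite (fn _ _ _ yx' (sy _ _ xy)) (negbTE xT).
rewrite disjoint_sym disjoints_subset -setCS setCK.
apply: close_sub.
  rewrite subUset sub1set in_setC xf /=.
  by rewrite -disjoints_subset.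
apply/subsetP => z /spreadP[//|[y [w [zy yw]]]]; rewrite in_setC => wf.
(* A leaf [w] has its mate as only neighbour, so spreading from [w] leads back to [w]. *)
have wX : w \notin exposed M by rewrite X0 inE.
have [y' wy'] := exposedPn _ _ wX.
have Ey : y' = y by apply: forkedPn wf (sub _ _ wy') _; rewrite e_sym.
by rewrite Ey in wy'; rewrite (fn _ _ _ (sy _ _ zy) (sy _ _ wy')) in_setC.
Qed.

(** * Optimality of the final set and private neighbours *)

Section Optimal.
Variable S : {set 'I_n}.
Hypotheses (admS : admits S) (freeS : free S = set0).
Hypothesis na : ~~ augmentable e M (level e M m).

Lemma mate_in x : x \notin S -> exists2 y, (x, y) \in M & y \in S.
Proof.
move=> xS; apply/partneredP; apply/negPn/negP => xP.
have : x \in free S by rewrite in_set xS.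
by rewrite freeS inE.
Qed.

(** If one end of an edge inside [S] is matched, closedness puts its mate into [S], a conflict; if
    both ends are exposed, the last level is augmentable. *)
Lemma admits_stable : stable e S.
Proof.
have [cl XS cons] := admS.
have mated y z z' : y \in S -> z \in S -> e y z -> (z, z') \in M -> False.
  move=> yS zS yz zz'; move/negP: (cons _ _ zz' zS); apply.
  exact: spread_mate yz zz'.
apply/forall_inP => y yS; apply/forall_inP => z zS; apply/negP => yz.
have [yX|/exposedPn[y' yy']] := boolP (y \in exposed M); last first.
  by apply: (mated _ _ _ zS yS _ yy'); rewrite e_sym.
have [zX|/exposedPn[z' zz']] := boolP (z \in exposed M); last exact: (mated _ _ _ yS zS yz zz').
move/negP: na; apply; apply/augmentableP; exists y, z; split=> //.
exact: (subsetP (exposed_sub_level _)).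
Qed.

Definition mate x := odflt x [pick y | (x, y) \in M].

Lemma mateP x y : (x, y) \in M -> mate x = y.
Proof.
have [_ _ fn] := matM; rewrite /mate; case: pickP => [z xz|/(_ y) /= ->] // xy.
exact: fn xz xy.
Qed.

Lemma mate_notin x : x \notin S -> (x, mate x) \in M /\ mate x \in S.
Proof. by move=> /mate_in[y xy yS]; rewrite (mateP xy). Qed.

Lemma mate_inj : {in ~: S &, injective mate}.
Proof.
have [sy _ fn] := matM; move=> x y /[!in_setC] /mate_notin[xm _] /mate_notin[ym _] E.
by rewrite E in xm; exact: fn (sy _ _ xm) (sy _ _ ym).
Qed.

(** [T] contains at most one end of each matching edge, so sending its vertices outside [S] to their
    mates embeds [T] into [S]. *)
Lemma admits_maximum T : stable e T -> #|T| <= #|S|.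
Proof.
have [sy sub fn] := matM => stT.
pose g x := if x \in S then x else mate x.
have nadj x y : x \in T -> y \in T -> (x, y) \in M -> False.
  move=> xT yT /sub; apply/negP.
  by move/forall_inP/(_ x xT)/forall_inP/(_ y yT): stT.
have ginj : {in T &, injective g}.
  move=> x y xT yT; rewrite /g; case: ifP => [xS|/negbT/mate_notin[xm _]];
    case: ifP => [yS|/negbT/mate_notin[ym _]] // E.
  - by rewrite -E in ym; case: (nadj _ _ yT xT ym).
  - by rewrite E in xm; case: (nadj _ _ xT yT xm).
  - by rewrite E in xm; exact: fn (sy _ _ xm) (sy _ _ ym).
rewrite -(card_in_imset ginj); apply: subset_leq_card; apply/subsetP => _ /imsetP[x _ ->].
by rewrite /g; case: ifP => // /negbT/mate_notin[].
Qed.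

(** For stable [T], [u] can replace [f]. Adjacency of [u] and [f] follows when [T] is maximum. *)
Definition private T := forall f, f \in T ->
  exists2 u, u \notin T & forall x, x \in T -> e u x -> x = f.

Lemma private_leaves T : stable e T -> #|T| = #|S| -> private T ->
  exposed M = set0 /\ forall x y, (x, y) \in M -> x \notin forked \/ y \notin forked.
Proof.
move=> stT cT prT; have [sy sub fn] := matM; have [cl XS cons] := admS.
have nadj x y : x \in T -> y \in T -> e x y -> False.
  by move=> xT yT; apply/negP; move/forall_inP/(_ x xT)/forall_inP/(_ y yT): stT.
pose pr f u := [&& u \notin T, e u f & [forall x in T, e u x ==> (x == f)]].
have prE f : f \in T -> exists u, pr f u.
  move=> fT; have [u uT H] := prT f fT; exists u; rewrite /pr uT /=.
  apply/andP; split; last first.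
    by apply/forall_inP => x xT; apply/implyP => /(H _ xT) ->.
  apply/negPn/negP => nuf.
  have : stable e (u |: T).
    have ux x : x \in T -> ~~ e u x.
      by move=> xT; apply/negP => ux; move: nuf; rewrite -(H x xT ux) ux.
    apply/forall_inP => x /setU1P[->|xT]; apply/forall_inP => y /setU1P[->|yT].
    - by rewrite e_irr.
    - exact: ux.
    - by rewrite e_sym ux.
    - by apply/negP; apply: nadj.
  by move=> /admits_maximum; rewrite cardsU1 uT cT ltnn.
pose h f := odflt f [pick u | pr f u].
have hP f : f \in T -> pr f (h f).
  by move=> /prE[u fu]; rewrite /h; case: pickP => [//|/(_ u)]; rewrite fu.
have hinj : {in T &, injective h}.
  move=> f g fT gT E; have /and3P[_ _ /forall_inP H] := hP g gT.
  have /and3P[_ ef _] := hP f fT; rewrite E in ef.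
  by have /implyP/(_ ef)/eqP := H f fT.
have hsub : h @: T \subset ~: T.
  by apply/subsetP => _ /imsetP[f fT ->]; rewrite in_setC; have /and3P[] := hP f fT.
have msub : mate @: (~: S) \subset S.
  by apply/subsetP => _ /imsetP[x /[!in_setC] /mate_notin[_ ?] ->].
(* Private neighbours inject [T] into its complement and mates inject the complement of [S] into
   [S]. As [#|T| = #|S|], all four sets have the same size and both maps are onto. *)
have c1 : #|T| <= #|~: T| by rewrite -(card_in_imset hinj); exact: subset_leq_card.
have c2 : #|~: S| <= #|S| by rewrite -(card_in_imset mate_inj); exact: subset_leq_card.
have cS : #|S| + #|~: S| = n by rewrite cardsC card_ord.
have cT' : #|T| + #|~: T| = n by rewrite cardsC card_ord.
have c3 : #|~: T| <= #|T| by clear - c1 c2 cS cT' cT; lia.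
have c4 : #|S| <= #|~: S| by clear - c1 c2 cS cT' cT; lia.
have hE : h @: T = ~: T by apply/eqP; rewrite eqEcard hsub card_in_imset.
have mE : mate @: (~: S) = S.
  by apply/eqP; rewrite eqEcard msub (card_in_imset mate_inj).
have X0 : exposed M = set0.
  apply/setP => x; rewrite [RHS]inE; apply/negP => xX.
  have := subsetP XS _ xX; rewrite -mE => /imsetP[y /[!in_setC] /mate_notin[ym _] E].
  by rewrite -E in ym; apply: exposedP xX (sy _ _ ym).
have outT v : v \notin T -> exists2 f, f \in T & v = h f.
  by rewrite -in_setC -hE => /imsetP[f fT ->]; exists f.
have nbr f y : f \in T -> e f y -> y = h f.
  move=> fT fy; have /outT[g gT E] : y \notin T by apply/negP => yT; apply: nadj fT yT fy.
  have /and3P[_ _ /forall_inP/(_ f fT)/implyP] := hP g gT.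
  by rewrite -E e_sym => /(_ fy)/eqP ->.
have leafT f : f \in T -> f \notin forked.
  move=> fT; rewrite inE; apply/existsPn => y; rewrite negb_and.
  have [fy|//] := boolP (e f y); apply/existsPn => y'; rewrite negb_and negbK.
  by have [fy'|//] := boolP (e f y'); rewrite (nbr _ _ fT fy) (nbr _ _ fT fy') eqxx orbT.
split=> // a b ab.
have [/leafT|aT] := boolP (a \in T); first by left.
have [/leafT|bT] := boolP (b \in T); first by right.
(* With both ends outside [T], [a] is the only neighbour of some [f] in [T], so the mate of [a] is
   [f] and not [b]. *)
have [f fT E] := outT a aT.
have fX : f \notin exposed M by rewrite X0 inE.
have [c fc] := exposedPn _ _ fX.
have Ec := nbr _ _ fT (sub _ _ fc).
rewrite Ec -E in fc.
by rewrite (fn _ _ _ ab (sy _ _ fc)) fT in bT.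
Qed.

(** The mate of [f] serves as [u]: a leaf of [S] adjacent to it is matched to it, hence is [f]. *)
Lemma leaves_private : exposed M = set0 -> [disjoint S & forked] -> private S.
Proof.
have [sy sub fn] := matM; have [cl XS cons] := admS.
move=> X0 dis f fS.
have mt x : exists y, (x, y) \in M by apply/exposedPn; rewrite X0 inE.
have [v fv] := mt f; exists v; first exact: cons fv fS.
move=> x xS vx; have [c xc] := mt x.
have xf : x \notin forked by rewrite (disjointFr dis xS).
have Ec : c = v by apply: forkedPn xf (sub _ _ xc) _; rewrite e_sym.
by rewrite Ec in xc; exact: fn (sy _ _ xc) (sy _ _ fv).
Qed.

End Optimal.
End Selection.

(** * Robust values *)

Section Robust.
Variables (n : nat) (e : rel 'I_n).
Hypotheses (e_sym : symmetric e) (e_irr : irreflexive e).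
Implicit Types S T : {set 'I_n}.

Lemma stableP S : reflect {in S &, forall x y, ~~ e x y} (stable e S).
Proof.
apply: (iffP idP) => [/forall_inP H x y xS yS|H].
  by move/forall_inP: (H x xS); apply.
by apply/forall_inP => x xS; apply/forall_inP => y yS; apply: H.
Qed.

Lemma robust_value_le S f : robust_value e S <= recover_value e S f.
Proof.
rewrite /robust_value; have : f \in index_enum (option 'I_n) by rewrite mem_index_enum.
elim: (index_enum _) => [|g s IH] //; rewrite inE big_cons => /orP[/eqP <-|/IH H].
  exact: geq_minl.
exact: leq_trans (geq_minr _ _) H.
Qed.

(** The bound [k <= n.+1] covers the default value of the minimum. *)
Lemma robust_value_ge S k : k <= n.+1 -> (forall f, k <= recover_value e S f) ->
  k <= robust_value e S.
Proof.
move=> kn H; apply: (big_ind (fun x => k <= x)) => // x y kx ky.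
by rewrite leq_min kx.
Qed.

Lemma recover_value_ge S f a : admissible_add e S f a ->
  #|add_vertex (del_vertex S f) a| <= recover_value e S f.
Proof. exact: leq_bigmax_cond. Qed.

Lemma recover_value_gtP S f k : k < recover_value e S f ->
  exists2 a, admissible_add e S f a & k < #|add_vertex (del_vertex S f) a|.
Proof.
move=> lt.
have /existsP[a /andP[]] : [exists a, admissible_add e S f a &&
    (k < #|add_vertex (del_vertex S f) a|)]; last by exists a.
apply: contraLR lt => /existsPn H; rewrite -leqNgt; apply/bigmax_leqP => a adm.
by have := H a; rewrite adm /= -leqNgt.
Qed.

Lemma stable_del S f : stable e S -> stable e (del_vertex S f).
Proof.
case: f => [v|//] /stableP st; apply/stableP => x y /setD1P[_ xS] /setD1P[_ yS].
exact: st.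
Qed.

Lemma admissible_none S f : stable e S -> admissible_add e S f None.
Proof. exact: stable_del. Qed.

Section Maximum.
Variable S : {set 'I_n}.
Hypotheses (stS : stable e S) (maxS : forall T, stable e T -> #|T| <= #|S|).

Lemma card_le_order : #|S| <= n.
Proof. by rewrite -[X in _ <= X](card_ord n) max_card. Qed.

Lemma robust_value_max T : robust_value e T <= #|S|.
Proof.
apply: leq_trans (robust_value_le _ None) _; apply/bigmax_leqP => a /andP[_ st].
exact: maxS.
Qed.

(** Adding no vertex loses at most the deleted one. *)
Lemma robust_value_pred : #|S|.-1 <= robust_value e S.
Proof.
apply: robust_value_ge; first by have := card_le_order; lia.
move=> f; apply: leq_trans (recover_value_ge (admissible_none f stS)) => /=.
case: f => [v|] /=; last by exact: leq_pred.
by rewrite (cardsD1 v S); case: (v \in S) => //=; exact: leq_pred.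
Qed.

(** When a vertex [v] of [S] is deleted, its private [u] takes its place. *)
Lemma robust_value_private : private e S -> #|S| <= robust_value e S.
Proof.
move=> pr; apply: robust_value_ge; first by have := card_le_order; lia.
have keep f : del_vertex S f = S -> #|S| <= recover_value e S f.
  by move=> E; have := recover_value_ge (admissible_none f stS); rewrite /= E.
case=> [v|]; last exact: keep.
have [vS|vS] := boolP (v \in S); last first.
  apply: keep; apply/setP => x; rewrite !inE; case: eqP => // ->.
  by rewrite (negbTE vS).
have [u uS H] := pr v vS.
have uv : u != v by apply/negP => /eqP E; rewrite E vS in uS.
have adm : admissible_add e S (Some v) (Some u).
  rewrite /admissible_add uS /=; apply/andP; split.
    by apply/negP => /eqP[E]; rewrite E eqxx in uv.
  have ux x : x \in S :\ v -> ~~ e u x.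
    by move=> /setD1P[xv xS]; apply/negP => /(H x xS) E; rewrite E eqxx in xv.
  apply/stableP => x y /setU1P[->|xS] /setU1P[->|yS].
  - by rewrite e_irr.
  - exact: ux.
  - by rewrite e_sym ux.
  - move/stableP: stS; apply; first by case/setD1P: xS.
    by case/setD1P: yS.
apply: leq_trans (recover_value_ge adm) => /=.
by rewrite cardsU1 in_setD1 (negbTE uS) andbF (cardsD1 v S) vS.
Qed.

(** Deleting [f] from [T] and recovering size [#|S|] forces [#|T| = #|S|] and the addition of a
    vertex whose only possible neighbour in [T] is [f]. An empty [T] needs the second
    alternative. *)
Lemma robust_value_ge_private T : stable e T -> 0 < #|S| -> #|S| <= robust_value e T ->
  (#|T| = #|S| /\ private e T) \/ private e S.
Proof.
move=> stT S0 rT.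
have rec f : exists2 a, admissible_add e T f a & #|S| <= #|add_vertex (del_vertex T f) a|.
  have lt : #|S|.-1 < recover_value e T f.
    by apply: leq_trans (robust_value_le _ _); rewrite prednK.
  by have [a H1] := recover_value_gtP lt; rewrite prednK // => H2; exists a.
have [T0|/set0Pn[f0 f0T]] := eqVneq T set0; last first.
  left.
  have key f : f \in T -> #|T| = #|S| /\ exists2 u, u \notin T &
      forall x, x \in T -> e u x -> x = f.
    move=> fT; have cT : #|T| = #|T :\ f|.+1 by rewrite (cardsD1 f T) fT.
    have mT : #|T| <= #|S| by exact: maxS.
    have [[u|] /andP[/= H st] card] := rec (Some f); last first.
      have card' : #|S| <= #|T :\ f| by exact: card.
      by lia.
    have /andP[uT _] := H.
    have card' : #|S| <= #|T :\ f|.+1.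
      by apply: leq_trans card _; rewrite cardsU1 in_setD1 (negbTE uT) andbF.
    split; first exact: anti_leq (introT andP (conj mT (leq_trans card' (eq_leq (esym cT))))).
    exists u => // x xT ux; apply/eqP; apply: contraT => xf.
    have := stableP _ st u x (setU11 _ _).
    by rewrite ux !inE xf xT orbT => /(_ isT).
  split; first by have [] := key f0 f0T.
  by move=> f fT; have [] := key f fT.
(* From the empty set one addition gives at most one vertex, so [S] is a single [s]; deleting [s]
   forbids adding it, so another vertex exists and is private for [s]. *)
right; rewrite T0 in rec.
have /card_gt0P[s sS] := S0.
have S1 : #|S| <= 1.
  have [[u|] _] := rec None; rewrite /= ?cards0; last by lia.
  by rewrite setU0 cards1.
have Ss : S = [set s].
  by apply/eqP; rewrite eq_sym eqEcard sub1set sS cards1.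
have [[u|] /andP[/= H _] card] := rec (Some s); last first.
  by have := leq_trans S0 card; rewrite set0D cards0.
move=> f; rewrite Ss inE => /eqP ->; exists u.
  have /andP[_ us] := H; rewrite inE; apply/negP => /eqP E.
  by rewrite E eqxx in us.
by move=> x; rewrite inE => /eqP.
Qed.

(** Only the values [#|S|.-1] and [#|S|] are at stake, and the larger one is equivalent to having
    private vertices. *)
Lemma robust_optimalP :
  (forall T, stable e T -> #|T| = #|S| -> private e T -> private e S) ->
  robust_optimal e S.
Proof.
move=> H; split=> // T stT.
have [le|lt] := leqP (robust_value e T) #|S|.-1.
  exact: leq_trans le robust_value_pred.
have rT := robust_value_max T.
have pr : private e S -> robust_value e T <= robust_value e S.
  by move=> /robust_value_private; apply: leq_trans.
apply: pr; case: (posnP #|S|) => [S0|S0].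
  by move=> f fS; move/eqP: S0; rewrite cards_eq0 => /eqP S0; rewrite S0 inE in fS.
have [|[cT pT]|//] := robust_value_ge_private stT S0; first by rewrite -(prednK S0).
exact: H pT.
Qed.

End Maximum.
End Robust.

(** * The relational program *)

(* [aE] edges, [aM] matching, [aS] chosen set, [aV] output mask, [aT] scratch,
   [aX] matched vertices, [aH] neighbours of [aS], [aG] a truth value, [aC] candidates,
   [aP] the selected candidate, [aW] the vertex hit by [aP], [aD] vertices whose mate is in [aS],
   [aL] vertices of degree at least two, [aQ] an intermediate result for [aL]. *)
Notation array := 'I_14.
Definition aE : array := @Ordinal 14 0 isT.
Definition aM : array := @Ordinal 14 1 isT.
Definition aS : array := @Ordinal 14 2 isT.
Definition aV : array := @Ordinal 14 3 isT.
Definition aT : array := @Ordinal 14 4 isT.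
Definition aX : array := @Ordinal 14 5 isT.
Definition aH : array := @Ordinal 14 6 isT.
Definition aG : array := @Ordinal 14 7 isT.
Definition aC : array := @Ordinal 14 8 isT.
Definition aP : array := @Ordinal 14 9 isT.
Definition aW : array := @Ordinal 14 10 isT.
Definition aD : array := @Ordinal 14 11 isT.
Definition aL : array := @Ordinal 14 12 isT.
Definition aQ : array := @Ordinal 14 13 isT.

Definition loop1 : name := @Ordinal 14 10 isT.
Definition loop2 : name := @Ordinal 14 11 isT.
Definition loop3 : name := @Ordinal 14 12 isT.
Definition loop4 : name := @Ordinal 14 13 isT.

(* A set [U] of vertices is stored as the relation [fun _ z => z \in U], so that its
   first row lists the members. *)
Definition In (a : array) i := At a i i.

(** [aG] is true at every entry exactly when the current set is augmentable; it then freezes [aS] as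
    in [grow]. *)
Definition search_body : rprog array :=
  RSeq (RUpd aH (And (At aE IZ IY) (In aS IY)))
 (RSeq (RUpd aG (And (Not (In aX IY)) (In aH IY)))
       (RUpd aS (Or (In aS IZ)
          (And (Not (In aG IZ)) (And (At aM IZ IY) (In aH IY)))))).

Definition search_prog : rprog array :=
  RSeq (RUpd aX (At aM IZ IY))
 (RSeq (RUpd aS (Not (In aX IZ)))
       (RIter loop4 search_body)).

Definition augment_prog : rprog array :=
  RSeq search_prog
 (RSeq (RUpd aC (And (Not (In aX IX)) (And (At aE IX IZ) (In aS IZ))))
 (RSeq (RFirst aP aC)
 (RSeq (RUpd aW (At aP IY IZ))
       (RUpd aM (Or (And (At aM IX IZ) (And (Not (In aW IX)) (Not (In aW IZ))))
          (Or (At aP IX IZ) (At aP IZ IX))))))).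

(** Three nested loops give [n ^ 6] rounds, which exceeds the initial potential once [n] is at least
    2. *)
Definition match_prog : rprog array :=
  RIter loop1 (RIter loop2 (RIter loop3 augment_prog)).

(** An update binds a single variable, so the two nested quantifiers need the intermediate relation
    [aQ]. *)
Definition forked_prog : rprog array :=
  RSeq (RUpd aQ (And (At aE IX IY) (Not (Eq _ IY IZ))))
       (RUpd aL (And (At aE IZ IY) (At aQ IZ IY))).

Definition spread_prog : rprog array :=
  RSeq (RUpd aH (And (At aE IZ IY) (In aS IY)))
       (RUpd aS (Or (In aS IZ) (And (At aM IZ IY) (In aH IY)))).

Definition enlarge_prog : rprog array :=
  RSeq (RUpd aD (And (At aM IZ IY) (In aS IY)))
 (RSeq (RUpd aG (And (And (Not (In aS IY)) (Not (In aD IY))) (Not (In aL IY))))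
 (RSeq (RUpd aC (And (Eq _ IX IZ) (And (And (Not (In aS IZ)) (Not (In aD IZ)))
          (Or (Not (In aG IZ)) (Not (In aL IZ))))))
 (RSeq (RFirst aP aC)
 (RSeq (RUpd aS (Or (In aS IZ) (At aP IZ IZ)))
       (RIter loop4 spread_prog))))).

Definition stable_prog : rprog array :=
  RSeq match_prog (RSeq search_prog (RSeq forked_prog (RIter loop1 enlarge_prog))).

Lemma stable_prog_rwf : rwf aT stable_prog.
Proof. by vm_compute. Qed.

Lemma stable_prog_wf : wf (whole aT aV stable_prog).
Proof. by vm_compute. Qed.

(** * The relational program computes the matching and the set *)

Section Link.
Variables (n : nat) (e : rel 'I_n).
Implicit Types (d : rels array n) (M : {set 'I_n * 'I_n}) (S : {set 'I_n}).

Definition stores_rel d a M := forall x y, d a x y = ((x, y) \in M).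
Definition stores_set d a S := forall x z, d a x z = (z \in S).
Definition invariant d M S := [/\ forall x y, d aE x y = e x y, stores_rel d aM M &
  stores_set d aS S].

(** Updates quantify over [IY] even when the formula does not mention it; [z] shows that the range
    is inhabited. *)
Lemma exists_const (z : 'I_n) b : [exists y : 'I_n, b] = b.
Proof. by apply/existsP/idP => [[]|H] //; exists z. Qed.

Lemma exists_orb (z : 'I_n) b (P : pred 'I_n) : [exists y, b || P y] = b || [exists y, P y].
Proof.
apply/existsP/orP => [[y /orP[|Py]]|[bT|/existsP[y Py]]].
- by left.
- by right; apply/existsP; exists y.
- by exists z; rewrite bT.
- by exists y; rewrite Py orbT.
Qed.

Lemma iter_invariant (X Y : Type) (R : X -> Y -> Prop) f g k x y :
  (forall x y, R x y -> R (f x) (g y)) -> R x y -> R (iter k f x) (iter k g y).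
Proof. by move=> H Rxy; elim: k => [|k IH] //=; apply: H. Qed.

Lemma is_first_firsts (r : 'I_n -> 'I_n -> bool) (C : {set 'I_n * 'I_n}) :
  (forall x y, r x y = ((x, y) \in C)) ->
  forall x y, is_first r x y = ((x, y) \in firsts C).
Proof.
move=> H x y; rewrite inE /is_first H; congr andb.
apply/forallP/forallP => [Hf [k l]|Hf k].
  by have /forallP/(_ l) := Hf k; rewrite H.
by apply/forallP => l; have := Hf (k, l); rewrite H.
Qed.

Lemma next_toE d S y : (forall x y, d aE x y = e x y) -> stores_set d aS S ->
  [exists w, d aE y w && d aS w w] = (y \in next_to e S).
Proof. by move=> dE dS; rewrite inE; apply: eq_existsb => w; rewrite dE dS. Qed.

Lemma search_bodyP d M S : invariant d M S /\ stores_set d aX (~: exposed M) ->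
  invariant (reval search_body d) M (grow e M S) /\
  stores_set (reval search_body d) aX (~: exposed M).
Proof.
move=> [[dE dM dS] dX]; split; last by move=> x z; rewrite /= /upd /=.
split=> // x z; rewrite /= /upd /= /value /=.
have -> : [exists y, ~~ d aX y y && [exists w, d aE y w && d aS w w]] = augmentable e M S.
  by apply: eq_existsb => u; rewrite dX in_setC negbK (next_toE _ dE dS).
rewrite dS exists_orb // /grow; case: augmentable => /=.
  by rewrite exists_const // orbF.
by rewrite !inE; congr orb; apply: eq_existsb => y; rewrite dM (next_toE _ dE dS).
Qed.

Lemma search_progP d M : (forall x y, d aE x y = e x y) -> stores_rel d aM M ->
  invariant (reval search_prog d) M (search e (n * n) M) /\
  stores_set (reval search_prog d) aX (~: exposed M).
Proof.
move=> dE dM.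
apply: (iter_invariant (R := fun d S => invariant d M S /\ stores_set d aX (~: exposed M))
  (f := reval search_body) (g := grow e M)); first by move=> d' S; apply: search_bodyP.
have XE z : [exists y, d aM z y] = (z \in ~: exposed M).
  by rewrite !inE negbK; apply: eq_existsb => y; rewrite dM.
split; first split=> //; move=> x z; rewrite /= /upd /= /value /= XE //.
by rewrite exists_const // in_setC negbK.
Qed.

Lemma augment_progP d M : (forall x y, d aE x y = e x y) /\ stores_rel d aM M ->
  (forall x y, reval augment_prog d aE x y = e x y) /\
  stores_rel (reval augment_prog d) aM (augment e (n * n) M).
Proof.
move=> [dE dM].
have [[dE1 dM1 dS1] dX1] := search_progP dE dM.
rewrite [reval augment_prog d]/=; set d1 := reval search_prog d in dE1 dM1 dS1 dX1 *.
rewrite -[iter _ _ _]/d1.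
split=> // x z; rewrite /upd /= /value /= exists_const //.
have CE : forall x y, value d1 (And (Not (In aX IX)) (And (At aE IX IZ) (In aS IZ))) x y =
    ((x, y) \in candidates e (n * n) M).
  move=> x' y; rewrite /value /= exists_const // [RHS]in_set /= dX1 dE1 dS1.
  by rewrite in_setC negbK.
have PE := is_first_firsts CE.
have WE w : [exists y, (y, w) \in firsts (candidates e (n * n) M)] =
    (w \in hit (firsts (candidates e (n * n) M))) by rewrite inE.
rewrite dM1 !PE.
under eq_existsb do rewrite PE.
under [in X in [&& _, _ & ~~ X]]eq_existsb do rewrite PE.
by rewrite !WE [RHS]in_set.
Qed.

Lemma match_progP d : (forall x y, d aE x y = e x y) -> stores_rel d aM set0 ->
  (forall x y, reval match_prog d aE x y = e x y) /\
  stores_rel (reval match_prog d) aM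
    (iter (n * n * (n * n * (n * n))) (augment e (n * n)) set0).
Proof.
move=> dE dM; set m := n * n.
pose R d M := (forall x y, d aE x y = e x y) /\ stores_rel d aM M.
rewrite iterM.
apply: (iter_invariant (R := R) (f := reval (RIter loop2 (RIter loop3 augment_prog)))
  (g := iter (m * m) (augment e m))) => // d1 M1 R1; rewrite iterM.
apply: (iter_invariant (R := R) (f := reval (RIter loop3 augment_prog))
  (g := iter m (augment e m))) => // d2 M2 R2.
by apply: (iter_invariant (R := R) (f := reval augment_prog)) => // d3 M3; apply: augment_progP.
Qed.

Lemma spread_progP d M S : invariant d M S /\ stores_set d aL (forked e) ->
  invariant (reval spread_prog d) M (spread e M S) /\
  stores_set (reval spread_prog d) aL (forked e).
Proof.
move=> [[dE dM dS] dL]; split; last by move=> x z; rewrite /= /upd /=.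
split=> // x z; rewrite /= /upd /= /value /= dS exists_orb //.
by rewrite !inE; congr orb; apply: eq_existsb => y; rewrite dM (next_toE _ dE dS).
Qed.

Lemma enlarge_progP d M S : invariant d M S /\ stores_set d aL (forked e) ->
  invariant (reval enlarge_prog d) M (enlarge e (n * n) M S) /\
  stores_set (reval enlarge_prog d) aL (forked e).
Proof.
move=> [[dE dM dS] dL].
apply: (iter_invariant (R := fun d S => invariant d M S /\ stores_set d aL (forked e))
  (f := reval spread_prog) (g := spread e M)); first by move=> d' T; apply: spread_progP.
rewrite [in X in invariant X]/= [in X in stores_set X]/=.
have DE z : [exists y, d aM z y && d aS y y] = (z \in partnered M S).
  by rewrite inE; apply: eq_existsb => y; rewrite dM dS.
set d1 := upd d aD _; set d2 := upd d1 aG _; set d3 := upd d2 aC _.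
have FE z : ~~ d1 aS z z && ~~ d1 aD z z = (z \in free M S).
  by rewrite /d1 /upd /= /value /= DE dS [RHS]in_set.
have GE x z : d2 aG x z = [exists y, (y \in free M S) && (y \notin forked e)].
  by apply: eq_existsb => y; rewrite /= -FE -[d1 aL]/(d aL) dL.
have CE : forall x y, d3 aC x y = ((x, y) \in [set p | (p.1 == p.2) && (p.2 \in picks e M S)]).
  move=> x y; rewrite in_set /= [_ \in picks _ _ _]in_set.
  rewrite /d3 {1}/upd /= /value /= exists_const //.
  by rewrite -[d2 aS]/(d1 aS) -[d2 aD]/(d1 aD) -[d2 aL]/(d aL) FE GE dL.
have PE := is_first_firsts CE.
split; last exact: dL.
split=> // x z; rewrite /upd /= /value /= exists_const //.
by rewrite -[d3 aS]/(d aS) dS PE in_setU [z \in picked _ _ _]in_set.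
Qed.

Lemma forked_progP d M S : invariant d M S ->
  invariant (reval forked_prog d) M S /\ stores_set (reval forked_prog d) aL (forked e).
Proof.
move=> [dE dM dS]; split=> // x z; rewrite /= /upd /= /value /= inE.
apply: eq_existsb => y; rewrite dE; congr andb.
by apply: eq_existsb => y'; rewrite dE.
Qed.

Definition chosen_set :=
  let M := iter (n * n * (n * n * (n * n))) (augment e (n * n)) set0 in
  iter (n * n) (enlarge e (n * n) M) (search e (n * n) M).

Lemma stable_progP x z :
  reval stable_prog (input_rels aE e) aS x z = (z \in chosen_set).
Proof.
have [||dE1 dM1] := @match_progP (input_rels aE e); first by [].
  by move=> x' y; rewrite inE.
have [inv2 _] := search_progP dE1 dM1.
have inv3 := forked_progP inv2.
have [[_ _ dS4] _] := iter_invariant (n * n) (@enlarge_progP^~ _) inv3.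
exact: dS4.
Qed.

End Link.

Lemma chosen_set_optimal n (e : rel 'I_n) :
  simple_graph e -> bipartite e -> robust_optimal e (chosen_set e).
Proof.
move=> [e_sym e_irr] [A e_bip]; set m := n * n.
have nm : n <= m by rewrite /m; nia.
rewrite /chosen_set -/m; set M := iter _ _ set0.
have [|matM sE na] := @iter_augment n e A m e_sym e_irr e_bip nm (m * (m * m)).
  (* From [4 <= m], the cube of [m] is at least [4 * m ^ 2], which exceeds [m * m.+2 + m.+1]. *)
  move=> n1; have m4 : 4 <= m by rewrite /m; nia.
  apply: (@leq_trans (m * m.+2 + m.+1)); first by rewrite leq_add2r leq_mul2r nm orbT.
  by rewrite mulnA; move: (m * m) (leq_mul m4 (leqnn m)) => mm; nia.
rewrite -/M in matM sE na.
have adm0 := admits_level e_sym nm matM na; rewrite -sE in adm0.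
have [adm fr0] := iter_enlarge e_sym e_bip nm matM nm adm0.
set S := iter m _ _ in adm fr0 *.
have stS := admits_stable e_sym matM adm na.
have maxS := admits_maximum matM fr0.
apply: robust_optimalP => // T stT cT prT.
have [X0 pair] := private_leaves e_sym e_irr matM adm fr0 stT cT prT.
apply: (leaves_private e_sym matM adm X0).
rewrite /S; apply: (iter_enlarge_leaves e_sym e_bip nm matM m X0 pair adm0).
(* Without exposed vertices every level is empty, so the selection starts from the empty set. *)
suff -> : search e m M = set0 by rewrite -setI_eq0 set0I.
rewrite sE /level X0; elim: {1}m => [|k IH] //=; rewrite IH.
by apply/setP => z; rewrite [RHS]inE; apply/negP => /spreadP[|[y [w [_ _]]]]; rewrite inE.
Qed.

Theorem theorem4 :
  exists (M : TM) (d : nat),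
    forall (n : nat) (e : rel 'I_n),
      simple_graph e -> bipartite e ->
      exists (k : nat) (c : config M),
        k <= d * (size (encode_graph e)) ^ d + d /\
        exec M k (init M (encode_graph e)) = Some c /\
        step M c = None /\
        size (output M c) = n /\
        robust_optimal e (decode_set n (output M c)).
Proof.
have [M [d H]] := @relational_tm _ aT aE aS aV isT isT _ stable_prog_rwf stable_prog_wf.
exists M, d => n e simple bip.
have [k [c [kb He Hs Hsz Hout]]] := H n e.
exists k, c; do 4!split=> //.
suff -> : decode_set n (output M c) = chosen_set e by apply: chosen_set_optimal.
apply/setP => j; rewrite inE.
(* Row [0] exists because the vertex [j] does. *)
pose i : 'I_n := Ordinal (leq_ltn_trans (leq0n j) (ltn_ord j)).
by rewrite (Hout i j) // stable_progP.
Qed.
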